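(* Let $(\mathcal{D}, \otimes, I)$ be a strict monoidal 2-category with a Como-algebra $(D,\nabla,\Delta,\eta)$. Then there exists a unique strict monoidal 2-functor $$(\mathbf{cospan}(\mathbf{sLin}), +, 0) \rightarrow (\mathcal{D}, \otimes, I)$$ mapping the Como-algebra $(1, \nabla, \Delta, \eta)$ of $\mathbf{cospan}(\mathbf{sLin})$ to $(D,\nabla,\Delta,\eta)$.
   Context: Composition is written in diagrammatic order: $f;g$ means first $f$, then $g$. In a 2-category, $\iota_f$ is the identity 2-cell on the 1-cell $f$, $\cdot$ is vertical and $\ast$ horizontal composition (both in diagrammatic order), and a 1-cell $f$ appearing in a $\ast$-expression stands for $\iota_f$. A strict monoidal 2-category $(\mathcal{D},\otimes,I)$ is a 2-category with a 2-functor $\otimes:\mathcal{D}\times\mathcal{D}\to\mathcal{D}$ and an object $I$ that are strictly associative and unital; strict monoidal 2-functors preserve this structure on the nose. $\mathbf{sLin}$ is the category with objects the finite ordinals $n=\{0<\dots<n-1\}$, $n\in\mathbb{N}$ (including $0=\emptyset$), and morphisms the monotone surjections; it is strict monoidal under ordinal addition $+$ with unit $0$. It has strict pushouts: every span $y\leftarrow x\to z$ can be completed to exactly one pushout square. The 2-category $\mathbf{cospan}(\mathbf{sLin})$ has: the same objects; 1-cells $X\to Y$ the cospans $(f_0:X\to A\leftarrow Y:f_1)$, composed by the (unique) pushout; 2-cells $(f_0:X\to A\leftarrow Y:f_1)\Rightarrow(g_0:X\to B\leftarrow Y:g_1)$ the morphisms $\alpha:A\to B$ of $\mathbf{sLin}$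 with $f_0;\alpha=g_0$ and $f_1;\alpha=g_1$; vertical composition is composition in $\mathbf{sLin}$, horizontal composition is the induced map between pushouts. It is a strict monoidal 2-category with unit $0$ and tensor $+$ given by ordinal addition applied componentwise to objects, to the legs of cospans, and to the maps representing 2-cells. A Como-algebra in $(\mathcal{D},\otimes,I)$ is $(D,\nabla,\Delta,\eta)$ where $D$ is an object and: (i) $\nabla:D\otimes D\to D$ is an associative and $\Delta:D\to D\otimes D$ a coassociative 1-cell; (ii) (separability) $\Delta;\nabla=id_D$; (iii) (Frobenius) $(\Delta\otimes id_D);(id_D\otimes\nabla)=\nabla;\Delta=(id_D\otimes\Delta);(\nabla\otimes id_D)$; (iv) $\eta: id_{D\otimes D}\Rightarrow \nabla;\Delta$ is a 2-cell with $\eta\ast\nabla=\iota_\nabla$ and $\Delta\ast\eta=\iota_\Delta$ (that is, $\nabla\dashv\Delta$ with unit $\eta$ and identity counit). The Como-algebra $(1,\nabla,\Delta,\eta)$ in $\mathbf{cospan}(\mathbf{sLin})$: let $\nabla:1+1\to 1$ be the unique surjection in $\mathbf{sLin}$. The 1-cell $\nabla:1+1\to1$ is the cospan $(\nabla:1+1\to 1\leftarrow 1:id)$, the 1-cell $\Delta:1\to1+1$ is the cospan $(id:1\to 1\leftarrow 1+1:\nabla)$, and $\eta: id_{1+1}\Rightarrow\nabla;\Delta$ is the 2-cell given by the map $\nabla:1+1\to 1$ of $\mathbf{sLin}$. *)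

(* Defs.v *)
From HB Require Import structures.
From mathcomp Require Import all_boot.

Set Implicit Arguments.
Unset Strict Implicit.
Unset Printing Implicit Defensive.

Declare Scope twocat_scope.
Delimit Scope twocat_scope with cat2.
Local Open Scope twocat_scope.

(* All compositions are in diagrammatic order. *)

Record twoData := TwoData {
  ob :> Type;
  hom : ob -> ob -> Type;
  cell : forall x y : ob, hom x y -> hom x y -> Type;
  id1 : forall x : ob, hom x x;
  comp1 : forall x y z : ob, hom x y -> hom y z -> hom x z;
  id2 : forall (x y : ob) (f : hom x y), cell f f;
  vcomp : forall (x y : ob) (f g h : hom x y),
    cell f g -> cell g h -> cell f h;
  hcomp : forall (x y z : ob) (f f' : hom x y) (g g' : hom y z),
    cell f f' -> cell g g' -> cell (comp1 f g) (comp1 f' g')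
}.

Arguments hom {t} x y.
Arguments cell {t x y} f g.
Arguments id1 {t} x.
Arguments comp1 {t x y z} f g.
Arguments id2 {t x y} f.
Arguments vcomp {t x y f g h} a b : rename.
Arguments hcomp {t x y z f f' g g'} a b : rename.

Notation "f ;; g" := (comp1 f g)
  (at level 50, left associativity) : twocat_scope.
Notation "a ;v b" := (vcomp a b)
  (at level 50, left associativity) : twocat_scope.
Notation "a ** b" := (hcomp a b)
  (at level 40, left associativity) : twocat_scope.

(* A 1-cell (resp. 2-cell) bundled with its boundary.  Two cells whose        *)
(* boundaries agree only up to a provable equality (for instance              *)
(* (f \ox g) \ox h and f \ox (g \ox h)) are compared by the equality of their *)
(* bundled versions, which includes the equality of the boundaries.           *)
Record arrow (C : twoData) :=
  Arrow { adom : C; acod : C; arrow_hom : hom adom acod }.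
Arguments Arrow {C adom acod} arrow_hom.

Record twocell (C : twoData) := Cell {
  cdom : C; ccod : C; csrc : hom cdom ccod; ctgt : hom cdom ccod;
  twocell_cell : cell csrc ctgt
}.
Arguments Cell {C cdom ccod csrc ctgt} twocell_cell.

Record twoCat := TwoCat {
  twoCat_data :> twoData;
  comp1_1f : forall (x y : twoCat_data) (f : hom x y), id1 x ;; f = f;
  comp1_f1 : forall (x y : twoCat_data) (f : hom x y), f ;; id1 y = f;
  comp1A : forall (x y z t : twoCat_data)
      (f : hom x y) (g : hom y z) (h : hom z t),
    f ;; (g ;; h) = f ;; g ;; h;
  vcomp_1a : forall (x y : twoCat_data) (f g : hom x y) (a : cell f g),
    id2 f ;v a = a;
  vcomp_a1 : forall (x y : twoCat_data) (f g : hom x y) (a : cell f g),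
    a ;v id2 g = a;
  vcompA : forall (x y : twoCat_data) (f g h k : hom x y)
      (a : cell f g) (b : cell g h) (c : cell h k),
    a ;v (b ;v c) = a ;v b ;v c;
  hcomp_id2 : forall (x y z : twoCat_data) (f : hom x y) (g : hom y z),
    id2 f ** id2 g = id2 (f ;; g);
  hcomp_vcomp : forall (x y z : twoCat_data)
      (f f' f'' : hom x y) (g g' g'' : hom y z)
      (a : cell f f') (a' : cell f' f'') (b : cell g g') (b' : cell g' g''),
    (a ;v a') ** (b ;v b') = (a ** b) ;v (a' ** b');
  hcomp_1a : forall (x y : twoCat_data) (f g : hom x y) (a : cell f g),
    Cell (id2 (id1 x) ** a) = Cell a;
  hcomp_a1 : forall (x y : twoCat_data) (f g : hom x y) (a : cell f g),
    Cell (a ** id2 (id1 y)) = Cell a;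
  hcompA : forall (x y z t : twoCat_data)
      (f f' : hom x y) (g g' : hom y z) (h h' : hom z t)
      (a : cell f f') (b : cell g g') (c : cell h h'),
    Cell (a ** (b ** c)) = Cell (a ** b ** c)
}.

Record twoFunctor (C D : twoCat) := TwoFunctor {
  F0 :> C -> D;
  F1 : forall x y : C, hom x y -> hom (F0 x) (F0 y);
  F2 : forall (x y : C) (f g : hom x y), cell f g -> cell (F1 f) (F1 g);
  F1_id : forall x : C, F1 (id1 x) = id1 (F0 x);
  F1_comp : forall (x y z : C) (f : hom x y) (g : hom y z),
    F1 (f ;; g) = F1 f ;; F1 g;
  F2_id : forall (x y : C) (f : hom x y), F2 (id2 f) = id2 (F1 f);
  F2_vcomp : forall (x y : C) (f g h : hom x y) (a : cell f g) (b : cell g h),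
    F2 (a ;v b) = F2 a ;v F2 b;
  F2_hcomp : forall (x y z : C) (f f' : hom x y) (g g' : hom y z)
      (a : cell f f') (b : cell g g'),
    Cell (F2 (a ** b)) = Cell (F2 a ** F2 b)
}.

Arguments F1 {C D} t {x y} f : rename.
Arguments F2 {C D} t {x y f g} a : rename.

Section Product.
Variables C D : twoCat.

Definition prodTwoData : twoData := {|
  ob := (C * D)%type;
  hom x y := (hom x.1 y.1 * hom x.2 y.2)%type;
  cell x y f g := (cell f.1 g.1 * cell f.2 g.2)%type;
  id1 x := (id1 x.1, id1 x.2);
  comp1 x y z f g := (f.1 ;; g.1, f.2 ;; g.2);
  id2 x y f := (id2 f.1, id2 f.2);
  vcomp x y f g h a b := (a.1 ;v b.1, a.2 ;v b.2);
  hcomp x y z f f' g g' a b := (a.1 ** b.1, a.2 ** b.2)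
|}.

Let pairCell (u : twocell C) (v : twocell D) : twocell prodTwoData :=
  @Cell prodTwoData (cdom u, cdom v) (ccod u, ccod v) (csrc u, csrc v)
    (ctgt u, ctgt v) (twocell_cell u, twocell_cell v).

Lemma prod_comp1_1f (x y : prodTwoData) (f : hom x y) : id1 x ;; f = f.
Proof. by case: f => f1 f2; rewrite /= !comp1_1f. Qed.

Lemma prod_comp1_f1 (x y : prodTwoData) (f : hom x y) : f ;; id1 y = f.
Proof. by case: f => f1 f2; rewrite /= !comp1_f1. Qed.

Lemma prod_comp1A (x y z t : prodTwoData)
    (f : hom x y) (g : hom y z) (h : hom z t) :
  f ;; (g ;; h) = f ;; g ;; h.
Proof. by rewrite /= !comp1A. Qed.

Lemma prod_vcomp_1a (x y : prodTwoData) (f g : hom x y) (a : cell f g) :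
  id2 f ;v a = a.
Proof. by case: a => a1 a2; rewrite /= !vcomp_1a. Qed.

Lemma prod_vcomp_a1 (x y : prodTwoData) (f g : hom x y) (a : cell f g) :
  a ;v id2 g = a.
Proof. by case: a => a1 a2; rewrite /= !vcomp_a1. Qed.

Lemma prod_vcompA (x y : prodTwoData) (f g h k : hom x y)
    (a : cell f g) (b : cell g h) (c : cell h k) :
  a ;v (b ;v c) = a ;v b ;v c.
Proof. by rewrite /= !vcompA. Qed.

Lemma prod_hcomp_id2 (x y z : prodTwoData) (f : hom x y) (g : hom y z) :
  id2 f ** id2 g = id2 (f ;; g).
Proof. by rewrite /= !hcomp_id2. Qed.

Lemma prod_hcomp_vcomp (x y z : prodTwoData)
    (f f' f'' : hom x y) (g g' g'' : hom y z)
    (a : cell f f') (a' : cell f' f'') (b : cell g g') (b' : cell g' g'') :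
  (a ;v a') ** (b ;v b') = (a ** b) ;v (a' ** b').
Proof. by rewrite /= !hcomp_vcomp. Qed.

Lemma prod_hcomp_1a (x y : prodTwoData) (f g : hom x y) (a : cell f g) :
  Cell (id2 (id1 x) ** a) = Cell a.
Proof.
case: x y f g a => [x1 x2] [y1 y2] [f1 f2] [g1 g2] [/= a1 a2].
exact: (f_equal2 pairCell (hcomp_1a a1) (hcomp_1a a2)).
Qed.

Lemma prod_hcomp_a1 (x y : prodTwoData) (f g : hom x y) (a : cell f g) :
  Cell (a ** id2 (id1 y)) = Cell a.
Proof.
case: x y f g a => [x1 x2] [y1 y2] [f1 f2] [g1 g2] [/= a1 a2].
exact: (f_equal2 pairCell (hcomp_a1 a1) (hcomp_a1 a2)).
Qed.

Lemma prod_hcompA (x y z t : prodTwoData)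
    (f f' : hom x y) (g g' : hom y z) (h h' : hom z t)
    (a : cell f f') (b : cell g g') (c : cell h h') :
  Cell (a ** (b ** c)) = Cell (a ** b ** c).
Proof.
case: x y z t f f' g g' h h' a b c => [x1 x2] [y1 y2] [z1 z2] [t1 t2].
move=> [f1 f2] [f1' f2'] [g1 g2] [g1' g2'] [h1 h2] [h1' h2'].
move=> [/= a1 a2] [/= b1 b2] [/= c1 c2].
exact: (f_equal2 pairCell (hcompA a1 b1 c1) (hcompA a2 b2 c2)).
Qed.

Definition prodTwoCat : twoCat :=
  TwoCat prod_comp1_1f prod_comp1_f1 prod_comp1A prod_vcomp_1a prod_vcomp_a1
    prod_vcompA prod_hcomp_id2 prod_hcomp_vcomp prod_hcomp_1a prod_hcomp_a1
    prod_hcompA.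

End Product.

Record monData := MonData {
  monData_cat :> twoCat;
  tens : twoFunctor (prodTwoCat monData_cat monData_cat) monData_cat;
  munit : monData_cat
}.

Arguments tens {m}.
Arguments munit {m}.

Section Tensor.
Variable C : monData.

Definition tens0 (x y : C) : C := F0 (@tens C) (x, y).

Definition tens1 (x y x' y' : C) (f : hom x y) (f' : hom x' y') :
    hom (tens0 x x') (tens0 y y') :=
  @F1 _ _ (@tens C) (x, x') (y, y') (f, f').

Definition tens2 (x y x' y' : C) (f g : hom x y) (f' g' : hom x' y')
    (a : cell f g) (a' : cell f' g') : cell (tens1 f f') (tens1 g g') :=
  @F2 _ _ (@tens C) (x, x') (y, y') (f, f') (g, g') (a, a').

End Tensor.

Notation "x \ox y" := (tens0 x y)
  (at level 40, left associativity) : twocat_scope.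
Notation "f \ox1 g" := (tens1 f g)
  (at level 40, left associativity) : twocat_scope.
Notation "a \ox2 b" := (tens2 a b)
  (at level 40, left associativity) : twocat_scope.

Record strictMon2Cat := StrictMon2Cat {
  strictMon2Cat_data :> monData;
  tens0A : forall x y z : strictMon2Cat_data,
    x \ox (y \ox z) = x \ox y \ox z;
  tens0_1x : forall x : strictMon2Cat_data, munit \ox x = x;
  tens0_x1 : forall x : strictMon2Cat_data, x \ox munit = x;
  tens1A : forall (x y x' y' x'' y'' : strictMon2Cat_data)
      (f : hom x y) (f' : hom x' y') (f'' : hom x'' y''),
    Arrow (f \ox1 (f' \ox1 f'')) = Arrow (f \ox1 f' \ox1 f'');
  tens1_1f : forall (x y : strictMon2Cat_data) (f : hom x y),
    Arrow (id1 munit \ox1 f) = Arrow f;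
  tens1_f1 : forall (x y : strictMon2Cat_data) (f : hom x y),
    Arrow (f \ox1 id1 munit) = Arrow f;
  tens2A : forall (x y x' y' x'' y'' : strictMon2Cat_data)
      (f g : hom x y) (f' g' : hom x' y') (f'' g'' : hom x'' y'')
      (a : cell f g) (a' : cell f' g') (a'' : cell f'' g''),
    Cell (a \ox2 (a' \ox2 a'')) = Cell (a \ox2 a' \ox2 a'');
  tens2_1a : forall (x y : strictMon2Cat_data) (f g : hom x y) (a : cell f g),
    Cell (id2 (id1 munit) \ox2 a) = Cell a;
  tens2_a1 : forall (x y : strictMon2Cat_data) (f g : hom x y) (a : cell f g),
    Cell (a \ox2 id2 (id1 munit)) = Cell a
}.

Record strictMon2Functor (C D : strictMon2Cat) := StrictMon2Functor {
  strictMon2Functor_functor :> twoFunctor C D;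
  F0_unit : strictMon2Functor_functor munit = munit;
  F0_tens : forall x y : C,
    strictMon2Functor_functor (x \ox y) =
    strictMon2Functor_functor x \ox strictMon2Functor_functor y;
  F1_tens : forall (x y x' y' : C) (f : hom x y) (f' : hom x' y'),
    Arrow (F1 strictMon2Functor_functor (f \ox1 f')) =
    Arrow (F1 strictMon2Functor_functor f \ox1 F1 strictMon2Functor_functor f');
  F2_tens : forall (x y x' y' : C) (f g : hom x y) (f' g' : hom x' y')
      (a : cell f g) (a' : cell f' g'),
    Cell (F2 strictMon2Functor_functor (a \ox2 a')) =
    Cell (F2 strictMon2Functor_functor a \ox2 F2 strictMon2Functor_functor a')
}.

(* For composites such as (delta \ox1 id1 d) ;; (id1 d \ox1 nabla), which go   *)
(* through d \ox d \ox d = d \ox (d \ox d), an equality that is only provable. *)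
Definition comp1_along (C : twoData) (x y y' z : C) (e : y = y')
    (f : hom x y) (g : hom y' z) : hom x z :=
  ecast w (hom x w) e f ;; g.

Record comoAlgebra (C : strictMon2Cat) := ComoAlgebra {
  como_ob : C;
  nabla : hom (como_ob \ox como_ob) como_ob;
  delta : hom como_ob (como_ob \ox como_ob);
  eta : cell (id1 (como_ob \ox como_ob)) (nabla ;; delta);
  nablaA :
    Arrow ((nabla \ox1 id1 como_ob) ;; nabla) =
    Arrow ((id1 como_ob \ox1 nabla) ;; nabla);
  deltaA :
    Arrow (delta ;; (delta \ox1 id1 como_ob)) =
    Arrow (delta ;; (id1 como_ob \ox1 delta));
  como_separable : delta ;; nabla = id1 como_ob;
  como_frobeniusl :
    comp1_along (esym (tens0A como_ob como_ob como_ob))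
      (delta \ox1 id1 como_ob) (id1 como_ob \ox1 nabla) = nabla ;; delta;
  como_frobeniusr :
    comp1_along (tens0A como_ob como_ob como_ob)
      (id1 como_ob \ox1 delta) (nabla \ox1 id1 como_ob) = nabla ;; delta;
  eta_nabla : Cell (eta ** id2 nabla) = Cell (id2 nabla);
  delta_eta : Cell (id2 delta ** eta) = Cell (id2 delta)
}.

Arguments nabla {C} c.
Arguments delta {C} c.
Arguments eta {C} c.

Definition maps_como (C D : strictMon2Cat) (F : strictMon2Functor C D)
    (A : comoAlgebra C) (B : comoAlgebra D) : Prop :=
  [/\ F (como_ob A) = como_ob B,
      Arrow (F1 F (nabla A)) = Arrow (nabla B),
      Arrow (F1 F (delta A)) = Arrow (delta B)
    & Cell (F2 F (eta A)) = Cell (eta B)].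

Definition monosurj (n m : nat) (f : 'I_n -> 'I_m) : bool :=
  [forall i : 'I_n, forall j : 'I_n, (i <= j) ==> (f i <= f j)]
    && [forall k, exists i, f i == k].

Record sLin (n m : nat) := SLin {
  sLin_fun :> {ffun 'I_n -> 'I_m};
  sLin_monosurj : monosurj sLin_fun
}.

HB.instance Definition _ n m := [isSub for @sLin_fun n m].
HB.instance Definition _ n m := [Equality of sLin n m by <:].

Lemma monosurjP n m (f : 'I_n -> 'I_m) :
  reflect ((forall i j : 'I_n, i <= j -> f i <= f j)
             /\ (forall k, exists i, f i = k)) (monosurj f).
Proof.
apply: (iffP andP) => -[H1 H2]; split.
- by move=> i j; apply/implyP; move/forallP/(_ i)/forallP: H1; apply.
- by move=> k; have /existsP[i /eqP] := forallP H2 k; exists i.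
- by apply/forallP=> i; apply/forallP=> j; apply/implyP; apply: H1.
- by apply/forallP=> k; apply/existsP; have [i <-] := H2 k; exists i.
Qed.

Lemma sLin_mono n m (f : sLin n m) (i j : 'I_n) : i <= j -> f i <= f j.
Proof. by have [H _] := monosurjP _ (sLin_monosurj f); apply: H. Qed.

Lemma sLin_surj n m (f : sLin n m) (k : 'I_m) : exists i, f i == k.
Proof.
by have [_ /(_ k)[i <-]] := monosurjP _ (sLin_monosurj f); exists i.
Qed.

Lemma sLin_ext n m (f g : sLin n m) : (forall i, f i = g i) -> f = g.
Proof. by move=> H; apply/val_inj/ffunP. Qed.

Lemma sid_subproof n : monosurj [ffun i : 'I_n => i].
Proof.
by apply/monosurjP; split=> [i j|k]; rewrite ?ffunE //; exists k; rewrite ffunE.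
Qed.

Definition sid n : sLin n n := SLin (sid_subproof n).

Lemma scomp_subproof n m p (f : sLin n m) (g : sLin m p) :
  monosurj [ffun i => g (f i)].
Proof.
apply/monosurjP; split=> [i j le_ij|k].
  by rewrite !ffunE; do 2 apply: sLin_mono.
have [j /eqP <-] := sLin_surj g k; have [i /eqP <-] := sLin_surj f j.
by exists i; rewrite ffunE.
Qed.

Definition scomp n m p (f : sLin n m) (g : sLin m p) : sLin n p :=
  SLin (scomp_subproof f g).

Definition sadd_fun n m n' m' (f : 'I_n -> 'I_m) (f' : 'I_n' -> 'I_m')
    (i : 'I_(n + n')) : 'I_(m + m') :=
  match split i with inl j => lshift m' (f j) | inr j => rshift m (f' j) end.

Lemma sadd_subproof n m n' m' (f : sLin n m) (f' : sLin n' m') :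
  monosurj [ffun i => sadd_fun f f' i].
Proof.
apply/monosurjP; split=> [i j|k].
  rewrite !ffunE /sadd_fun; case: split_ordP => i' ->; case: split_ordP => j' ->.
  - by move=> le_ij; apply: (sLin_mono f).
  - by move=> _; apply: ltnW (leq_trans (ltn_ord _) (leq_addr _ _)).
  - by rewrite /= leqNgt (leq_trans (ltn_ord j') (leq_addr _ _)).
  - by rewrite /= !leq_add2l; apply: (sLin_mono f').
case: (split_ordP k) => k' ->.
- have [i /eqP <-] := sLin_surj f k'; exists (lshift _ i).
  by rewrite ffunE /sadd_fun (unsplitK (inl _ i)).
- have [i /eqP <-] := sLin_surj f' k'; exists (rshift _ i).
  by rewrite ffunE /sadd_fun (unsplitK (inr _ i)).
Qed.

Definition sadd n m n' m' (f : sLin n m) (f' : sLin n' m') :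
    sLin (n + n') (m + m') :=
  SLin (sadd_subproof f f').

Arguments sid : simpl never.
Arguments scomp : simpl never.
Arguments sadd : simpl never.

Lemma sidE n (i : 'I_n) : sid n i = i.
Proof. by rewrite ffunE. Qed.

Lemma scompE n m p (f : sLin n m) (g : sLin m p) i : scomp f g i = g (f i).
Proof. by rewrite ffunE. Qed.

Lemma sadd_lshift n m n' m' (f : sLin n m) (f' : sLin n' m') i :
  sadd f f' (lshift n' i) = lshift m' (f i).
Proof. by rewrite ffunE /sadd_fun (unsplitK (inl _ i)). Qed.

Lemma sadd_rshift n m n' m' (f : sLin n m) (f' : sLin n' m') i :
  sadd f f' (rshift n i) = rshift m (f' i).
Proof. by rewrite ffunE /sadd_fun (unsplitK (inr _ i)). Qed.

Lemma scomp1f n m (f : sLin n m) : scomp (sid n) f = f.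
Proof. by apply: sLin_ext => i; rewrite scompE sidE. Qed.

Lemma scompf1 n m (f : sLin n m) : scomp f (sid m) = f.
Proof. by apply: sLin_ext => i; rewrite scompE sidE. Qed.

Lemma scompA n m p q (f : sLin n m) (g : sLin m p) (h : sLin p q) :
  scomp f (scomp g h) = scomp (scomp f g) h.
Proof. by apply: sLin_ext => i; rewrite !scompE. Qed.

Lemma sadd_id n m : sadd (sid n) (sid m) = sid (n + m).
Proof.
apply: sLin_ext => i; rewrite sidE.
by case: (split_ordP i) => j ->; rewrite ?sadd_lshift ?sadd_rshift sidE.
Qed.

Lemma sadd_comp n m p n' m' p' (f : sLin n m) (g : sLin m p)
    (f' : sLin n' m') (g' : sLin m' p') :
  sadd (scomp f g) (scomp f' g') = scomp (sadd f f') (sadd g g').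
Proof.
apply: sLin_ext => i; rewrite scompE.
by case: (split_ordP i) => j ->; rewrite ?sadd_lshift ?sadd_rshift scompE.
Qed.

Lemma scomp_epi n m p (f : sLin n m) (g h : sLin m p) :
  scomp f g = scomp f h -> g = h.
Proof.
move=> E; apply: sLin_ext => j; have [i /eqP <-] := sLin_surj f j.
by rewrite -!scompE E.
Qed.

Lemma sLin_leq n m (f : sLin n m) : m <= n.
Proof.
have inj : injective (fun k => xchoose (sLin_surj f k)).
  move=> j k E; rewrite -(eqP (xchooseP (sLin_surj f j))) E.
  exact: (eqP (xchooseP (sLin_surj f k))).
by have := leq_card _ inj; rewrite !card_ord.
Qed.

Lemma sLin_endo n (f : sLin n n) : f = sid n.
Proof.
have lef k (i : 'I_n) : f i = k :> nat -> k <= i.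
  elim: k i => // k IHk i Ei.
  have ltk : k < n by apply: ltn_trans (ltn_ord (f i)); rewrite Ei.
  have [j /eqP Ej] := sLin_surj f (Ordinal ltk).
  have /IHk le_kj : f j = k :> nat by rewrite Ej.
  apply: leq_ltn_trans le_kj _; rewrite ltnNge; apply/negP => /(sLin_mono f).
  by rewrite Ei Ej /= ltnn.
have gef d (i : 'I_n) : f i + d.+1 = n -> i <= f i.
  elim: d i => [|d IHd] i Ei; first by rewrite -ltnS -[(f i).+1]addn1 Ei.
  have ltk : (f i).+1 < n by rewrite -[ltnRHS]Ei addnS ltnS addnS ltnS leq_addr.
  have [j /eqP Ej] := sLin_surj f (Ordinal ltk).
  have /IHd le_jf : f j + d.+1 = n by rewrite Ej /= addSnnS.
  rewrite -ltnS -[(f i).+1]/(Ordinal ltk : nat) -Ej.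
  apply: leq_trans le_jf; rewrite ltnNge; apply/negP => /(sLin_mono f).
  by rewrite Ej /= ltnn.
apply: sLin_ext => i; rewrite sidE; apply/val_inj/eqP; rewrite eqn_leq.
rewrite (lef _ i erefl) (gef (n - (f i).+1)) // -addSnnS subnKC //.
Qed.

Lemma sdesc_subproof n p k (e : sLin n p) (w : sLin n k)
    (ker : forall i j, e i = e j -> w i = w j) :
  monosurj [ffun x => w (xchoose (sLin_surj e x))].
Proof.
have eK x := eqP (xchooseP (sLin_surj e x)).
apply/monosurjP; split=> [x y le_xy|z].
  rewrite !ffunE; have [->//|neq_xy] := eqVneq x y.
  apply: sLin_mono; rewrite leqNgt; apply/negP => /ltnW/(sLin_mono e).
  rewrite !eK => le_yx; case/eqP: neq_xy; apply/val_inj/eqP.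
  by rewrite eqn_leq le_xy.
have [i /eqP <-] := sLin_surj w z; exists (e i).
by rewrite ffunE; apply: ker; rewrite eK.
Qed.

Definition sdesc n p k (e : sLin n p) (w : sLin n k)
    (ker : forall i j, e i = e j -> w i = w j) : sLin p k :=
  SLin (sdesc_subproof ker).

Lemma sdescK n p k (e : sLin n p) (w : sLin n k)
    (ker : forall i j, e i = e j -> w i = w j) : scomp e (sdesc ker) = w.
Proof.
apply: sLin_ext => i; rewrite scompE ffunE; apply: ker.
exact: (eqP (xchooseP (sLin_surj e (e i)))).
Qed.

Definition is_pushout x y z (f : sLin x y) (g : sLin x z)
    p (a : sLin y p) (b : sLin z p) : Prop :=
  scomp f a = scomp g b /\
  forall k (u : sLin y k) (v : sLin z k), scomp f u = scomp g v ->
    exists! w : sLin p k, scomp a w = u /\ scomp b w = v.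

Section Pushout.
Variables (x y z : nat) (f : sLin x y) (g : sLin x z).

(* The pushout as a quotient of x into intervals: its elements are given by   *)
(* their least representatives, i.e. by the elements of x that neither f nor  *)
(* g identifies with a smaller one.                                           *)
Definition po_starts : {set 'I_x} :=
  [set i : 'I_x | [forall j : 'I_x, (j < i) ==> (f j < f i) && (g j < g i)]].

Definition po_ob : nat := #|po_starts|.

Let cnt (m : nat) : nat := #|[set s in po_starts | s <= m]|.

Let cnt_mono m n : m <= n -> cnt m <= cnt n.
Proof.
move=> le_mn; apply/subset_leq_card/subsetP => s; rewrite !inE.
by case/andP=> -> /leq_trans->.
Qed.

Let cnt_lt (i s : 'I_x) : s \in po_starts -> i < s -> cnt i < cnt s.
Proof.
move=> sS lt_is; apply: proper_card; apply/properP; split.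
  apply/subsetP => t; rewrite !inE => /andP[-> le_ti].
  exact: leq_trans le_ti (ltnW lt_is).
by exists s; rewrite inE sS ?leqnn // -ltnNge.
Qed.

Let cntS m : cnt m.+1 <= (cnt m).+1.
Proof.
have [le_xm|lt_mx] := leqP x m.+1.
  apply: leqW; apply/subset_leq_card/subsetP => t; rewrite !inE => /andP[-> _].
  by rewrite -ltnS (leq_trans (ltn_ord t)).
apply: (@leq_trans #|Ordinal lt_mx |: [set s in po_starts | s <= m]|).
  apply/subset_leq_card/subsetP => t; rewrite !inE => /andP[-> /=].
  by rewrite leq_eqVlt.
by rewrite cardsU1; exact: leq_add (leq_b1 _) (leqnn _).
Qed.

Let cnt_gt0 (i : 'I_x) : 0 < cnt i.
Proof.
have lt0x : 0 < x by apply: leq_ltn_trans (ltn_ord i).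
apply/card_gt0P; exists (Ordinal lt0x); rewrite !inE andbT.
by apply/forallP=> j; apply/implyP.
Qed.

Let cnt_le m : cnt m <= po_ob.
Proof. by apply/subset_leq_card/subsetP => t; rewrite inE => /andP[]. Qed.

Let cnt_lt_ob (i : 'I_x) : (cnt i).-1 < po_ob.
Proof. by rewrite prednK ?cnt_gt0 ?cnt_le. Qed.

Lemma po_diag_subproof : monosurj [ffun i : 'I_x => Ordinal (cnt_lt_ob i)].
Proof.
apply/monosurjP; split=> [i j le_ij|k].
  by rewrite !ffunE /= -!subn1 leq_sub2r ?cnt_mono.
have lt0x : 0 < x.
  rewrite lt0n; apply/eqP => x0; have := leq_trans (ltn_ord k) (max_card _).
  by rewrite card_ord x0 ltn0.
have cnt_last : cnt x.-1 = po_ob.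
  apply: eq_card => t; rewrite inE -ltnS prednK ?ltn_ord ?andbT //.
have ivt m : k < cnt m -> exists2 i, i <= m & cnt i = k.+1.
  elim: m => [|m IHm] lt_k.
    exists 0 => //; apply/eqP; rewrite eqn_leq lt_k andbT.
    apply: (@leq_trans #|[set Ordinal lt0x]|); last by rewrite cards1.
    apply/subset_leq_card/subsetP=> t; rewrite !inE leqn0 => /andP[_ /eqP t0].
    exact/eqP/val_inj.
  have [eq_k|ne_k] := eqVneq (cnt m.+1) k.+1; first by exists m.+1.
  have /IHm[i le_im Ei] : k < cnt m.
    by rewrite -ltnS (leq_trans _ (cntS m)) // ltn_neqAle eq_sym ne_k.
  by exists i => //; apply: leqW.
have [i le_i Ei] : exists2 i, i <= x.-1 & cnt i = k.+1.
  by apply: ivt; rewrite cnt_last.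
have lt_ix : i < x by rewrite -(prednK lt0x).
by exists (Ordinal lt_ix); apply: val_inj; rewrite ffunE /= Ei.
Qed.

Definition po_diag : sLin x po_ob := SLin po_diag_subproof.

Let po_diag_cnt (i j : 'I_x) : po_diag i = po_diag j <-> cnt i = cnt j.
Proof.
split=> [/(congr1 val)|E]; last by apply: val_inj; rewrite !ffunE /= E.
by rewrite !ffunE /= => E; rewrite -(prednK (cnt_gt0 i)) E prednK.
Qed.

Lemma po_diag_ker T (u : 'I_y -> T) (v : 'I_z -> T) :
  (forall i, u (f i) = v (g i)) ->
  forall i j, po_diag i = po_diag j -> u (f i) = u (f j).
Proof.
move=> uv i j /po_diag_cnt.
wlog le_ij : i j / i <= j => [IH|].
  by have [/IH//|/ltnW/IH H /esym/H ->] := leqP i j.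
case: j le_ij => m ltm /=; elim: m ltm => [|m IHm] ltm le_im Ecnt.
  by congr (u (f _)); apply: val_inj; apply/eqP; rewrite -leqn0.
move: le_im; rewrite leq_eqVlt => /predU1P[Ei|lt_im].
  by congr (u (f _)); apply: val_inj.
have ltm' := ltnW ltm; pose m' := Ordinal ltm'; pose m1 := Ordinal ltm.
rewrite (IHm ltm') //; last first.
  by apply/eqP; rewrite eqn_leq cnt_mono //= Ecnt cnt_mono /=.
have : m1 \notin po_starts.
  by apply/negP=> /cnt_lt/(_ lt_im); rewrite Ecnt ltnn.
have le_mm : m' <= m1 by apply: leqnSn.
rewrite inE => /forallPn[l]; rewrite negb_imply negb_and -!leqNgt /=.
rewrite ltnS => /andP[le_lm /orP[] le1].
- congr u; apply/val_inj/eqP; rewrite eqn_leq sLin_mono //=.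
  by apply: leq_trans le1 _; apply: sLin_mono.
- rewrite !uv; congr v; apply/val_inj/eqP; rewrite eqn_leq sLin_mono //=.
  by apply: leq_trans le1 _; apply: sLin_mono.
Qed.

Let diag_ker (i j : 'I_x) : f i = f j \/ g i = g j -> po_diag i = po_diag j.
Proof.
move=> E; apply/po_diag_cnt; wlog le_ij : i j E / i <= j => [IH|].
  have [/IH->//|/ltnW/IH H] := leqP i j.
  by rewrite H //; case: E => ->; [left | right].
have [//|ne] := eqVneq (cnt i) (cnt j).
have [s] : exists s, s \in [set s in po_starts | i < s <= j].
  apply/set0Pn/eqP => S0; case/eqP: ne; apply/eqP.
  rewrite eqn_leq cnt_mono //=; apply/subset_leq_card/subsetP=> t.
  rewrite !inE => /andP[tS le_tj]; rewrite tS /= leqNgt; apply/negP => lt_it.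
  by have := in_set0 t; rewrite -S0 !inE tS lt_it le_tj.
rewrite !inE => /and3P[/forallP/(_ i)/implyP H /H/andP[lt_f lt_g] le_sj].
case: E => E.
- by have := leq_trans lt_f (sLin_mono f le_sj); rewrite E ltnn.
- by have := leq_trans lt_g (sLin_mono g le_sj); rewrite E ltnn.
Qed.

Let diag_kerl (i j : 'I_x) : f i = f j -> po_diag i = po_diag j.
Proof. by move=> E; apply: diag_ker; left. Qed.

Let diag_kerr (i j : 'I_x) : g i = g j -> po_diag i = po_diag j.
Proof. by move=> E; apply: diag_ker; right. Qed.

Definition po_inl : sLin y po_ob := sdesc diag_kerl.
Definition po_inr : sLin z po_ob := sdesc diag_kerr.

Lemma po_comm : scomp f po_inl = scomp g po_inr.
Proof. by rewrite !sdescK. Qed.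

Section Universal.
Variables (k : nat) (u : sLin y k) (v : sLin z k).
Hypothesis uv : scomp f u = scomp g v.

Lemma po_rec_subproof (i j : 'I_x) :
  po_diag i = po_diag j -> scomp f u i = scomp f u j.
Proof.
by rewrite !scompE; apply: (po_diag_ker (v := v)) => l; rewrite -!scompE uv.
Qed.

Definition po_rec : sLin po_ob k := sdesc po_rec_subproof.

Lemma po_recl : scomp po_inl po_rec = u.
Proof. by apply: (@scomp_epi _ _ _ f); rewrite scompA !sdescK. Qed.

Lemma po_recr : scomp po_inr po_rec = v.
Proof. by apply: (@scomp_epi _ _ _ g); rewrite scompA !sdescK. Qed.

End Universal.

Lemma po_is_pushout : is_pushout f g po_inl po_inr.
Proof.
split=> [|k u v uv]; first exact: po_comm.
exists (po_rec uv); split=> [|w [w1 _]].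
  by split; [apply: po_recl | apply: po_recr].
by apply: (@scomp_epi _ _ _ po_inl); rewrite po_recl.
Qed.

Lemma pushout_unique p (a : sLin y p) (b : sLin z p) :
  is_pushout f g a b ->
  existT (fun q => (sLin y q * sLin z q)%type) p (a, b) =
  existT (fun q => (sLin y q * sLin z q)%type) po_ob (po_inl, po_inr).
Proof.
move=> [ab univ]; have [w [[<- <-] _]] := univ _ _ _ po_comm.
have := sLin_leq w; have := sLin_leq (po_rec ab).
move: w (po_rec ab) => w _ le1 le2.
have E : p = po_ob by apply/eqP; rewrite eqn_leq le1.
by case: _ / E w {le1 le2} => w; rewrite (sLin_endo w) !scompf1.
Qed.

End Pushout.

Record cospan (x y : nat) := Cospan {
  apex : nat;
  legl : sLin x apex;
  legr : sLin y apex
}.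

Record cospan_cell (x y : nat) (c d : cospan x y) := CospanCell {
  cell_map : sLin (apex c) (apex d);
  cell_mapl : scomp (legl c) cell_map = legl d;
  cell_mapr : scomp (legr c) cell_map = legr d
}.

Lemma cospan_cell_irr x y (c d : cospan x y) (a b : cospan_cell c d) : a = b.
Proof.
case: a b => a al ar [b bl br].
have E : a = b by apply: (@scomp_epi _ _ _ (legl c)); rewrite al.
by case: _ / E in bl br *; congr CospanCell; apply: eq_irrelevance.
Qed.

Lemma cospan_eq_apex x y (c d : cospan x y) :
  cospan_cell c d -> apex c <= apex d -> c = d.
Proof.
case: c d => A f0 f1 [B g0 g1] [/= a <- <-] le_AB.
have E : A = B by apply/eqP; rewrite eqn_leq le_AB (sLin_leq a).
by case: _ / E a {le_AB} => a; rewrite (sLin_endo a) !scompf1.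
Qed.

Lemma cospan_anti x y (c d : cospan x y) :
  cospan_cell c d -> cospan_cell d c -> c = d.
Proof. by move=> a b; apply: cospan_eq_apex a (sLin_leq (cell_map b)). Qed.

Definition cospan_id (x : nat) : cospan x x := Cospan (sid x) (sid x).

Definition cospan_comp x y z (c : cospan x y) (d : cospan y z) : cospan x z :=
  Cospan (scomp (legl c) (po_inl (legr c) (legl d)))
         (scomp (legr d) (po_inr (legr c) (legl d))).

Definition cospan_id2 x y (c : cospan x y) : cospan_cell c c :=
  CospanCell (scompf1 (legl c)) (scompf1 (legr c)).

Section VComp.
Variables (x y : nat) (c d e : cospan x y).
Variables (a : cospan_cell c d) (b : cospan_cell d e).

Lemma cospan_vcomp_l :
  scomp (legl c) (scomp (cell_map a) (cell_map b)) = legl e.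
Proof. by rewrite scompA !cell_mapl. Qed.

Lemma cospan_vcomp_r :
  scomp (legr c) (scomp (cell_map a) (cell_map b)) = legr e.
Proof. by rewrite scompA !cell_mapr. Qed.

Definition cospan_vcomp : cospan_cell c e :=
  CospanCell cospan_vcomp_l cospan_vcomp_r.

End VComp.

Section HComp.
Variables (x y z : nat) (c c' : cospan x y) (d d' : cospan y z).
Variables (a : cospan_cell c c') (b : cospan_cell d d').

Lemma cospan_hcomp_comm :
  scomp (legr c) (scomp (cell_map a) (po_inl (legr c') (legl d'))) =
  scomp (legl d) (scomp (cell_map b) (po_inr (legr c') (legl d'))).
Proof. by rewrite !scompA cell_mapr cell_mapl po_comm. Qed.

Lemma cospan_hcomp_l :
  scomp (legl (cospan_comp c d)) (po_rec cospan_hcomp_comm) =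
  legl (cospan_comp c' d').
Proof. by rewrite /= -scompA po_recl scompA cell_mapl. Qed.

Lemma cospan_hcomp_r :
  scomp (legr (cospan_comp c d)) (po_rec cospan_hcomp_comm) =
  legr (cospan_comp c' d').
Proof. by rewrite /= -scompA po_recr scompA cell_mapr. Qed.

Definition cospan_hcomp : cospan_cell (cospan_comp c d) (cospan_comp c' d') :=
  @CospanCell _ _ (cospan_comp c d) (cospan_comp c' d')
    (po_rec cospan_hcomp_comm) cospan_hcomp_l cospan_hcomp_r.

End HComp.

Definition cospanData : twoData := {|
  ob := nat;
  hom := cospan;
  cell := cospan_cell;
  id1 := cospan_id;
  comp1 := cospan_comp;
  id2 := cospan_id2;
  vcomp := cospan_vcomp;
  hcomp := cospan_hcomp
|}.

Lemma cospan_comp_cell x y z (c : cospan x y) (d : cospan y z)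
    (e : cospan x z) (u : sLin (apex c) (apex e)) (v : sLin (apex d) (apex e)) :
  scomp (legr c) u = scomp (legl d) v ->
  scomp (legl c) u = legl e -> scomp (legr d) v = legr e ->
  cospan_cell (cospan_comp c d) e.
Proof.
by move=> uv ul vr; exists (po_rec uv); rewrite /= -scompA ?po_recl ?po_recr.
Qed.

Lemma cospan_comp_1f x y (f : cospan x y) : cospan_comp (cospan_id x) f = f.
Proof.
apply: cospan_anti.
  apply: (@cospan_comp_cell _ _ _ (cospan_id x) f f (legl f) (sid _)).
  1-3: by rewrite /= ?scomp1f ?scompf1.
exists (po_inr (legr (cospan_id x)) (legl f)) => //.
by rewrite /= -po_comm /= !scomp1f.
Qed.

Lemma cospan_comp_f1 x y (f : cospan x y) : cospan_comp f (cospan_id y) = f.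
Proof.
apply: cospan_anti.
  apply: (@cospan_comp_cell _ _ _ f (cospan_id y) f (sid _) (legr f)).
  1-3: by rewrite /= ?scomp1f ?scompf1.
exists (po_inl (legr f) (legl (cospan_id y))) => //.
by rewrite /= po_comm /= !scomp1f.
Qed.

Lemma cospan_compA x y z t (f : cospan x y) (g : cospan y z) (h : cospan z t) :
  cospan_comp f (cospan_comp g h) = cospan_comp (cospan_comp f g) h.
Proof.
set fg := cospan_comp f g; set gh := cospan_comp g h.
pose lfg := po_inl (legr f) (legl g); pose rfg := po_inr (legr f) (legl g).
pose lgh := po_inl (legr g) (legl h); pose rgh := po_inr (legr g) (legl h).
have Efg : scomp (legr f) lfg = scomp (legl g) rfg by apply: po_comm.
have Egh : scomp (legr g) lgh = scomp (legl h) rgh by apply: po_comm.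
pose l1 := po_inl (legr f) (legl gh); pose r1 := po_inr (legr f) (legl gh).
pose l2 := po_inl (legr fg) (legl h); pose r2 := po_inr (legr fg) (legl h).
have E1 : scomp (legr f) l1 = scomp (scomp (legl g) lgh) r1 by apply: po_comm.
have E2 : scomp (scomp (legr g) rfg) l2 = scomp (legl h) r2 by apply: po_comm.
apply: cospan_anti.
- have E : scomp (legr g) (scomp rfg l2) = scomp (legl h) r2.
    by rewrite scompA.
  apply: (@cospan_comp_cell _ _ _ f gh (cospan_comp fg h)
            (scomp lfg l2) (po_rec E)).
  + by rewrite [legl gh]/= -scompA po_recl !scompA Efg.
  + by rewrite scompA.
  + by rewrite [legr gh]/= -scompA po_recr.
- have E : scomp (legr f) l1 = scomp (legl g) (scomp lgh r1).
    by rewrite scompA.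
  apply: (@cospan_comp_cell _ _ _ fg h (cospan_comp f gh)
            (po_rec E) (scomp rgh r1)).
  + by rewrite [legr fg]/= -scompA po_recr !scompA Egh.
  + by rewrite [legl fg]/= -scompA po_recl.
  + by rewrite scompA.
Qed.

Lemma cospan_Arrow_inj (x y : cospanData) (f g : hom x y) :
  Arrow f = Arrow g -> f = g.
Proof.
pose cast (w : arrow cospanData) : hom x y :=
  match @eqP nat (adom w) x, @eqP nat (acod w) y with
  | ReflectT e1, ReflectT e2 =>
      ecast i (@hom cospanData i y) e1
        (ecast j (@hom cospanData (adom w) j) e2 (arrow_hom w))
  | _, _ => f
  end.
have castK w : cast (@Arrow cospanData x y w) = w.
  rewrite /cast /=; case: eqP => // e1; case: eqP => // e2.
  by rewrite (eq_axiomK e1) (eq_axiomK e2).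
by move=> /(congr1 cast); rewrite !castK.
Qed.

Lemma cospan_Cell_eq (x y x' y' : cospanData) (f g : hom x y)
    (f' g' : hom x' y') (a : cell f g) (b : cell f' g') :
  Arrow f = Arrow f' -> Arrow g = Arrow g' -> Cell a = Cell b.
Proof.
move=> Ef Eg; have /= Ex := congr1 (@adom _) Ef.
have /= Ey := congr1 (@acod _) Ef.
case: _ / Ex f' g' b Ef Eg => f' g' b Ef Eg.
case: _ / Ey f' g' b Ef Eg => f' g' b Ef Eg.
move/cospan_Arrow_inj: Ef b => <-; move/cospan_Arrow_inj: Eg => <- b.
by rewrite (cospan_cell_irr a b).
Qed.

Lemma cospan_Arrow_eq (x y x' y' : nat) (f : cospan x y) (f' : cospan x' y') :
  x = x' -> y = y' -> apex f = apex f' ->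
  (forall (i : 'I_x) (j : 'I_x'), i = j :> nat -> legl f i = legl f' j :> nat) ->
  (forall (i : 'I_y) (j : 'I_y'), i = j :> nat -> legr f i = legr f' j :> nat) ->
  @Arrow cospanData _ _ f = @Arrow cospanData _ _ f'.
Proof.
case: f f' => A f0 f1 [B g0 g1] /= Ex Ey EA.
case: _ / Ex g0 => g0; case: _ / Ey g1 => g1; case: _ / EA g0 g1 => g0 g1 E0 E1.
congr (@Arrow cospanData _ _ (Cospan _ _)).
- by apply: sLin_ext => i; apply/val_inj/E0.
- by apply: sLin_ext => i; apply/val_inj/E1.
Qed.

Lemma cospan_vcomp_1a x y (f g : cospan x y) (a : cospan_cell f g) :
  cospan_vcomp (cospan_id2 f) a = a.
Proof. exact: cospan_cell_irr. Qed.

Lemma cospan_vcomp_a1 x y (f g : cospan x y) (a : cospan_cell f g) :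
  cospan_vcomp a (cospan_id2 g) = a.
Proof. exact: cospan_cell_irr. Qed.

Lemma cospan_vcompA x y (f g h k : cospan x y) (a : cospan_cell f g)
    (b : cospan_cell g h) (c : cospan_cell h k) :
  cospan_vcomp a (cospan_vcomp b c) = cospan_vcomp (cospan_vcomp a b) c.
Proof. exact: cospan_cell_irr. Qed.

Lemma cospan_hcomp_id2 x y z (f : cospan x y) (g : cospan y z) :
  cospan_hcomp (cospan_id2 f) (cospan_id2 g) = cospan_id2 (cospan_comp f g).
Proof. exact: cospan_cell_irr. Qed.

Lemma cospan_hcomp_vcomp x y z (f f' f'' : cospan x y) (g g' g'' : cospan y z)
    (a : cospan_cell f f') (a' : cospan_cell f' f'')
    (b : cospan_cell g g') (b' : cospan_cell g' g'') :
  cospan_hcomp (cospan_vcomp a a') (cospan_vcomp b b') =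
  cospan_vcomp (cospan_hcomp a b) (cospan_hcomp a' b').
Proof. exact: cospan_cell_irr. Qed.

Lemma cospan_hcomp_1a (x y : cospanData) (f g : hom x y) (a : cell f g) :
  Cell (id2 (id1 x) ** a) = Cell a.
Proof. by apply: cospan_Cell_eq; rewrite /= cospan_comp_1f. Qed.

Lemma cospan_hcomp_a1 (x y : cospanData) (f g : hom x y) (a : cell f g) :
  Cell (a ** id2 (id1 y)) = Cell a.
Proof. by apply: cospan_Cell_eq; rewrite /= cospan_comp_f1. Qed.

Lemma cospan_hcompA (x y z t : cospanData)
    (f f' : hom x y) (g g' : hom y z) (h h' : hom z t)
    (a : cell f f') (b : cell g g') (c : cell h h') :
  Cell (a ** (b ** c)) = Cell (a ** b ** c).
Proof. by apply: cospan_Cell_eq; rewrite /= cospan_compA. Qed.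

Definition cospanTwoCat : twoCat :=
  @TwoCat cospanData cospan_comp_1f cospan_comp_f1 cospan_compA
    cospan_vcomp_1a cospan_vcomp_a1 cospan_vcompA cospan_hcomp_id2
    cospan_hcomp_vcomp cospan_hcomp_1a cospan_hcomp_a1 cospan_hcompA.

Definition cospan_add x y x' y' (c : cospan x y) (c' : cospan x' y') :
    cospan (x + x') (y + y') :=
  Cospan (sadd (legl c) (legl c')) (sadd (legr c) (legr c')).

Section AddCell.
Variables (x y x' y' : nat) (c d : cospan x y) (c' d' : cospan x' y').
Variables (a : cospan_cell c d) (a' : cospan_cell c' d').

Lemma cospan_add2_l :
  scomp (legl (cospan_add c c')) (sadd (cell_map a) (cell_map a')) =
  legl (cospan_add d d').
Proof. by rewrite /= -sadd_comp !cell_mapl. Qed.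

Lemma cospan_add2_r :
  scomp (legr (cospan_add c c')) (sadd (cell_map a) (cell_map a')) =
  legr (cospan_add d d').
Proof. by rewrite /= -sadd_comp !cell_mapr. Qed.

Definition cospan_add2 : cospan_cell (cospan_add c c') (cospan_add d d') :=
  @CospanCell _ _ (cospan_add c c') (cospan_add d d')
    (sadd (cell_map a) (cell_map a')) cospan_add2_l cospan_add2_r.

End AddCell.

Lemma cospan_add_id x x' :
  cospan_add (cospan_id x) (cospan_id x') = cospan_id (x + x').
Proof. by rewrite /cospan_add /= sadd_id. Qed.

Lemma leq_po_add x y z x' y' z' (f : sLin x y) (g : sLin x z)
    (f' : sLin x' y') (g' : sLin x' z') :
  po_ob (sadd f f') (sadd g g') <= po_ob f g + po_ob f' g'.
Proof.
pose S := lshift x' @: po_starts f g; pose S' := @rshift x x' @: po_starts f' g'.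
apply: (@leq_trans #|S :|: S'|); last first.
  by rewrite (leq_trans (leq_card_setU _ _)) // leq_add // leq_imset_card.
apply/subset_leq_card/subsetP => i; rewrite !inE => /forallP Hi.
apply/orP; case: (split_ordP i) Hi => j -> Hj; [left | right].
  apply: imset_f; rewrite inE; apply/forallP => k; apply/implyP => lt_kj.
  by have := Hj (lshift x' k); rewrite /= lt_kj !sadd_lshift.
apply: imset_f; rewrite inE; apply/forallP => k; apply/implyP => lt_kj.
by have := Hj (rshift x k); rewrite /= !sadd_rshift /= !ltn_add2l lt_kj.
Qed.

Lemma cospan_add_comp x y z x' y' z' (c : cospan x y) (d : cospan y z)
    (c' : cospan x' y') (d' : cospan y' z') :
  cospan_add (cospan_comp c d) (cospan_comp c' d') =
  cospan_comp (cospan_add c c') (cospan_add d d').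
Proof.
apply/esym/cospan_eq_apex; last exact: leq_po_add.
pose f := legr c; pose g := legl d; pose f' := legr c'; pose g' := legl d'.
apply: (@cospan_comp_cell _ _ _ (cospan_add c c') (cospan_add d d')
          (cospan_add (cospan_comp c d) (cospan_comp c' d'))
          (sadd (po_inl f g) (po_inl f' g'))
          (sadd (po_inr f g) (po_inr f' g'))).
all: by rewrite /= -!sadd_comp -?po_comm.
Qed.

Lemma cospan_add_id2 x x' y y' (f : cospan x y) (f' : cospan x' y') :
  cospan_add2 (cospan_id2 f) (cospan_id2 f') = cospan_id2 (cospan_add f f').
Proof. exact: cospan_cell_irr. Qed.

Lemma cospan_add_vcomp x y x' y' (f g h : cospan x y) (f' g' h' : cospan x' y')
    (a : cospan_cell f g) (b : cospan_cell g h)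
    (a' : cospan_cell f' g') (b' : cospan_cell g' h') :
  cospan_add2 (cospan_vcomp a b) (cospan_vcomp a' b') =
  cospan_vcomp (cospan_add2 a a') (cospan_add2 b b').
Proof. exact: cospan_cell_irr. Qed.

Lemma cospan_add_hcomp x y z x' y' z'
    (f g : cospan x y) (h k : cospan y z)
    (f' g' : cospan x' y') (h' k' : cospan y' z')
    (a : cospan_cell f g) (b : cospan_cell h k)
    (a' : cospan_cell f' g') (b' : cospan_cell h' k') :
  @Cell cospanData _ _ _ _
    (cospan_add2 (cospan_hcomp a b) (cospan_hcomp a' b')) =
  @Cell cospanData _ _ _ _
    (cospan_hcomp (cospan_add2 a a') (cospan_add2 b b')).
Proof. by apply: cospan_Cell_eq; rewrite /= -cospan_add_comp. Qed.

Definition cospan_tens : twoFunctor (prodTwoCat cospanTwoCat cospanTwoCat)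
                                    cospanTwoCat :=
  @TwoFunctor (prodTwoCat cospanTwoCat cospanTwoCat) cospanTwoCat
    (fun x => x.1 + x.2)
    (fun x y f => cospan_add f.1 f.2)
    (fun x y f g a => cospan_add2 a.1 a.2)
    (fun x => cospan_add_id x.1 x.2)
    (fun x y z f g => cospan_add_comp f.1 g.1 f.2 g.2)
    (fun x y f => cospan_add_id2 f.1 f.2)
    (fun x y f g h a b => cospan_add_vcomp a.1 b.1 a.2 b.2)
    (fun x y z f f' g g' a b => cospan_add_hcomp a.1 b.1 a.2 b.2).

Definition cospanMonData : monData := @MonData cospanTwoCat cospan_tens 0.

Lemma sadd_val n m n' m' (f : sLin n m) (f' : sLin n' m')
    (i : 'I_(n + n')) :
  (forall j : 'I_n, i = j :> nat -> sadd f f' i = f j :> nat) /\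
  (forall j : 'I_n', i = n + j :> nat -> sadd f f' i = m + f' j :> nat).
Proof.
split=> j Ei.
- by rewrite (_ : i = lshift n' j) ?sadd_lshift //; apply: val_inj.
- by rewrite (_ : i = rshift n j) ?sadd_rshift //; apply: val_inj.
Qed.

Lemma saddA n m n' m' n'' m''
    (f : sLin n m) (f' : sLin n' m') (f'' : sLin n'' m'')
    (i : 'I_(n + (n' + n''))) (j : 'I_(n + n' + n'')) :
  i = j :> nat -> sadd f (sadd f' f'') i = sadd (sadd f f') f'' j :> nat.
Proof.
case: (split_ordP i) => [k|k] ->.
  move=> Ej; rewrite sadd_lshift.
  have [/(_ (lshift n' k) (esym Ej)) -> _] := sadd_val (sadd f f') f'' j.
  by rewrite sadd_lshift.
rewrite sadd_rshift; case: (split_ordP k) => l -> Ej.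
  rewrite sadd_lshift.
  have [/(_ (rshift n l) (esym Ej)) -> _] := sadd_val (sadd f f') f'' j.
  by rewrite sadd_rshift.
rewrite sadd_rshift; have Ej' : j = n + n' + l :> nat by rewrite -Ej /= addnA.
by have [_ /(_ l Ej') ->] := sadd_val (sadd f f') f'' j; rewrite /= addnA.
Qed.

Lemma sadd_1f n m (f : sLin n m) (i : 'I_(0 + n)) (j : 'I_n) :
  i = j :> nat -> sadd (sid 0) f i = f j :> nat.
Proof. by move=> Ei; have [_ /(_ j Ei) ->] := sadd_val (sid 0) f i. Qed.

Lemma sadd_f1 n m (f : sLin n m) (i : 'I_(n + 0)) (j : 'I_n) :
  i = j :> nat -> sadd f (sid 0) i = f j :> nat.
Proof. by move=> Ei; have [/(_ j Ei) -> _] := sadd_val f (sid 0) i. Qed.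

Lemma cospan_addA (x y x' y' x'' y'' : cospanMonData)
    (f : hom x y) (f' : hom x' y') (f'' : hom x'' y'') :
  Arrow (f \ox1 (f' \ox1 f'')) = Arrow (f \ox1 f' \ox1 f'').
Proof.
by apply: cospan_Arrow_eq; [exact: addnA.. | exact: saddA | exact: saddA].
Qed.

Lemma cospan_add_1f (x y : cospanMonData) (f : hom x y) :
  Arrow (id1 munit \ox1 f) = Arrow f.
Proof. by apply: cospan_Arrow_eq => //; apply: sadd_1f. Qed.

Lemma cospan_add_f1 (x y : cospanMonData) (f : hom x y) :
  Arrow (f \ox1 id1 munit) = Arrow f.
Proof.
by apply: cospan_Arrow_eq; [exact: addn0.. | exact: sadd_f1 | exact: sadd_f1].
Qed.

Lemma cospan_add2A (x y x' y' x'' y'' : cospanMonData)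
    (f g : hom x y) (f' g' : hom x' y') (f'' g'' : hom x'' y'')
    (a : cell f g) (a' : cell f' g') (a'' : cell f'' g'') :
  Cell (a \ox2 (a' \ox2 a'')) = Cell (a \ox2 a' \ox2 a'').
Proof. by apply: cospan_Cell_eq; apply: cospan_addA. Qed.

Lemma cospan_add2_1a (x y : cospanMonData) (f g : hom x y) (a : cell f g) :
  Cell (id2 (id1 munit) \ox2 a) = Cell a.
Proof. by apply: cospan_Cell_eq; apply: cospan_add_1f. Qed.

Lemma cospan_add2_a1 (x y : cospanMonData) (f g : hom x y) (a : cell f g) :
  Cell (a \ox2 id2 (id1 munit)) = Cell a.
Proof. by apply: cospan_Cell_eq; apply: cospan_add_f1. Qed.

Definition cospan_sLin : strictMon2Cat :=
  @StrictMon2Cat cospanMonData addnA add0n addn0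
    cospan_addA cospan_add_1f cospan_add_f1
    cospan_add2A cospan_add2_1a cospan_add2_a1.

Lemma sto1_subproof n : monosurj [ffun _ : 'I_n.+1 => @ord0 0].
Proof.
apply/monosurjP; split=> [i j|k]; first by rewrite !ffunE.
by exists ord0; rewrite ffunE ord1.
Qed.

Definition sto1 n : sLin n.+1 1 := SLin (sto1_subproof n).

Definition nabla1 : @hom cospan_sLin (1 + 1) 1 := Cospan (sto1 1) (sid 1).
Definition delta1 : @hom cospan_sLin 1 (1 + 1) := Cospan (sid 1) (sto1 1).

Lemma sLin1_eq n (f g : sLin n 1) : f = g.
Proof. by apply: sLin_ext => i; rewrite !ord1. Qed.

Lemma cospan_apex1 x y (c d : cospan x y) :
  apex c = 1 -> apex d = 1 -> c = d.
Proof.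
case: c d => A f0 f1 [B g0 g1] /= EA EB.
case: _ / (esym EA) f0 f1 => f0 f1; case: _ / (esym EB) g0 g1 => g0 g1.
by rewrite (sLin1_eq f0 g0) (sLin1_eq f1 g1).
Qed.

Lemma po_ob_gt0 x y z (f : sLin x.+1 y) (g : sLin x.+1 z) : 0 < po_ob f g.
Proof. exact: leq_ltn_trans (ltn_ord (po_diag f g ord0)). Qed.

Lemma po_ob1l x z (f : sLin x.+1 1) (g : sLin x.+1 z) : po_ob f g = 1.
Proof. by apply/eqP; rewrite eqn_leq (sLin_leq (po_inl f g)) po_ob_gt0. Qed.

Lemma po_ob1r x y (f : sLin x.+1 y) (g : sLin x.+1 1) : po_ob f g = 1.
Proof. by apply/eqP; rewrite eqn_leq (sLin_leq (po_inr f g)) po_ob_gt0. Qed.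

Lemma po_obC x y z (f : sLin x y) (g : sLin x z) : po_ob f g = po_ob g f.
Proof.
by apply: eq_card => i; rewrite !inE; apply: eq_forallb => j; rewrite andbC.
Qed.

Lemma po_ob_frobenius :
  po_ob (sadd (sto1 1) (sid 1)) (sadd (sid 1) (sto1 1)) = 1.
Proof.
set f := sadd (sto1 1) (sid 1); set g := sadd (sid 1) (sto1 1).
pose i0 : 'I_2 := ord0; pose i1 : 'I_2 := ord_max.
pose l := po_inl f g; pose r := po_inr f g.
have lr i : l (f i) = r (g i) by rewrite -!scompE po_comm.
have E : l (lshift 1 ord0) = l (rshift 1 ord0).
  have e1 : lshift 1 i1 = rshift 1 i0 by apply: val_inj.
  have e2 : rshift 2 ord0 = rshift 1 i1 by apply: val_inj.
  have -> : lshift 1 ord0 = f (lshift 1 i1) by rewrite sadd_lshift ord1.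
  have -> : rshift 1 ord0 = f (rshift 2 ord0) by rewrite sadd_rshift sidE.
  by rewrite !lr e1 e2 !sadd_rshift !ord1.
apply/eqP; rewrite eqn_leq po_ob_gt0 andbT -[po_ob f g]card_ord.
apply/card_le1_eqP => j k _ _.
have [p /eqP <-] := sLin_surj l j; have [q /eqP <-] := sLin_surj l k.
by case: (split_ordP p) => p' ->; case: (split_ordP q) => q' ->;
  rewrite !(ord1 p') !(ord1 q').
Qed.

(* The codomain is 1, as the pushout of two identities (po_ob1l), and po_inl  *)
(* is the resulting identity: this map is sto1 1.                             *)
Definition eta1_map : sLin (1 + 1) (apex (nabla1 ;; delta1)) :=
  scomp (sto1 1) (po_inl (sid 1) (sid 1)).

Lemma eta1_map_l : scomp (sid (1 + 1)) eta1_map = legl (nabla1 ;; delta1).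
Proof. exact: scomp1f. Qed.

Lemma eta1_map_r : scomp (sid (1 + 1)) eta1_map = legr (nabla1 ;; delta1).
Proof.
rewrite scomp1f /eta1_map; congr scomp.
by have := po_comm (sid 1) (sid 1); rewrite !scomp1f.
Qed.

Definition eta1 : cell (id1 (1 + 1 : cospan_sLin)) (nabla1 ;; delta1) :=
  @CospanCell _ _ (cospan_id (1 + 1)) (cospan_comp nabla1 delta1)
    eta1_map eta1_map_l eta1_map_r.

Local Notation u1 := (1 : cospan_sLin).

Lemma nabla1A :
  Arrow ((nabla1 \ox1 id1 u1) ;; nabla1) = Arrow ((id1 u1 \ox1 nabla1) ;; nabla1).
Proof.
by apply: (congr1 (@Arrow cospanData 3 1)); apply: cospan_apex1; apply: po_ob1r.
Qed.

Lemma delta1A :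
  Arrow (delta1 ;; (delta1 \ox1 id1 u1)) = Arrow (delta1 ;; (id1 u1 \ox1 delta1)).
Proof.
by apply: (congr1 (@Arrow cospanData 1 3)); apply: cospan_apex1; apply: po_ob1l.
Qed.

Lemma como1_separable : delta1 ;; nabla1 = id1 u1.
Proof. by apply: cospan_apex1 => //; apply: po_ob1l. Qed.

Lemma comp1_along_id (x y z : cospanData) (e : y = y) (f : hom x y)
    (g : hom y z) : comp1_along e f g = f ;; g.
Proof. by rewrite (eq_axiomK (e : y = y :> nat)). Qed.

Lemma como1_frobeniusl :
  comp1_along (esym (tens0A u1 u1 u1)) (delta1 \ox1 id1 u1) (id1 u1 \ox1 nabla1)
  = nabla1 ;; delta1.
Proof.
rewrite (@comp1_along_id 2 3 2).
by apply: cospan_apex1; [apply: po_ob_frobenius | apply: po_ob1l].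
Qed.

Lemma como1_frobeniusr :
  comp1_along (tens0A u1 u1 u1) (id1 u1 \ox1 delta1) (nabla1 \ox1 id1 u1)
  = nabla1 ;; delta1.
Proof.
rewrite (@comp1_along_id 2 3 2).
by apply: cospan_apex1; [rewrite [apex _]po_obC; apply: po_ob_frobenius | apply: po_ob1l].
Qed.

Lemma eta1_nabla1 : Cell (eta1 ** id2 nabla1) = Cell (id2 nabla1).
Proof.
apply: cospan_Cell_eq; congr Arrow; apply: cospan_apex1 => //.
- exact: po_ob1r.
- exact: po_ob1r.
Qed.

Lemma delta1_eta1 : Cell (id2 delta1 ** eta1) = Cell (id2 delta1).
Proof.
apply: cospan_Cell_eq; congr Arrow; apply: cospan_apex1 => //.
- exact: po_ob1l.
- exact: po_ob1l.
Qed.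

Definition como1 : comoAlgebra cospan_sLin :=
  @ComoAlgebra cospan_sLin 1 nabla1 delta1 eta1 nabla1A delta1A
    como1_separable como1_frobeniusl como1_frobeniusr eta1_nabla1 delta1_eta1.

(* Main.v *)
(** Every cospan of monotone surjections is [f0] followed by the reverse of
    [f1], and monotone surjections are generated by the merging [2 -> 1] under
    composition and tensor.  In a 2-category with a Como-algebra, a surjection
    [f] is sent to a composite [S f] of multiplications and its reverse to a
    composite [T f] of comultiplications; then [S f] is left adjoint to [T f]
    with identity counit and a unit [H f] built from [eta].  A unit of such an
    adjunction is unique, which yields all equations between 2-cells.
    Separability and the Frobenius law give the Beck-Chevalley identity
    [T f ; S g = S p ; T q] for the pushout [(p, q)] of [(f, g)], so that
    [(f0, f1)] going to [S f0 ; T f1] is functorial.  Conversely [S f], [T f]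
    and [H f], computed in cospan(sLin) itself, are the cospans and cells they
    stand for, and every strict monoidal 2-functor preserves them. *)

From mathcomp Require Import all_boot boolp.
Require Import Defs.

Set Implicit Arguments.
Unset Strict Implicit.
Unset Printing Implicit Defensive.

(** * One-sorted strict monoidal 2-categories *)

(* The carrier stands for the 2-cells of a strict monoidal 2-category together
   with an absorbing value for undefined composites, so that associativity
   holds unconditionally; 1-cells and objects are identified with their
   identity 2-cells.  [hc], [vc], [tn] are horizontal composition, vertical
   composition and tensor; [dm], [cd] are the source and target objects, [sr],
   [tg] the source and target 1-cells. *)
Record cellAlg := CellAlg {
  carrier :> Type;
  hc : carrier -> carrier -> carrier;
  vc : carrier -> carrier -> carrier;
  tn : carrier -> carrier -> carrier;
  dm : carrier -> carrier;
  cd : carrier -> carrier;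
  sr : carrier -> carrier;
  tg : carrier -> carrier;
  un : carrier;
  hcA : associative hc;
  hc_dm : forall u, hc (dm u) u = u;
  hc_cd : forall u, hc u (cd u) = u;
  dm_dm : forall u, dm (dm u) = dm u;
  cd_dm : forall u, cd (dm u) = dm u;
  dm_cd : forall u, dm (cd u) = cd u;
  cd_cd : forall u, cd (cd u) = cd u;
  dm_hc : forall u v, cd u = dm v -> dm (hc u v) = dm u;
  cd_hc : forall u v, cd u = dm v -> cd (hc u v) = cd v;
  vc_sr : forall u, vc (sr u) u = u;
  vc_tg : forall u, vc u (tg u) = u;
  tg_sr : forall u, tg (sr u) = sr u;
  sr_tg : forall u, sr (tg u) = tg u;
  sr_vc : forall u v, tg u = sr v -> sr (vc u v) = sr u;
  tg_vc : forall u v, tg u = sr v -> tg (vc u v) = tg v;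
  dm_sr : forall u, dm (sr u) = dm u;
  cd_sr : forall u, cd (sr u) = cd u;
  sr_dm : forall u, sr (dm u) = dm u;
  sr_cd : forall u, sr (cd u) = cd u;
  sr_hc : forall u v, sr (hc u v) = hc (sr u) (sr v);
  tg_hc : forall u v, tg (hc u v) = hc (tg u) (tg v);
  hc_vc : forall u u' v v', tg u = sr u' -> tg v = sr v' ->
    hc (vc u u') (vc v v') = vc (hc u v) (hc u' v');
  tnA : associative tn;
  tn1u : left_id un tn;
  tnu1 : right_id un tn;
  dm_un : dm un = un;
  dm_tn : forall u v, dm (tn u v) = tn (dm u) (dm v);
  cd_tn : forall u v, cd (tn u v) = tn (cd u) (cd v);
  sr_tn : forall u v, sr (tn u v) = tn (sr u) (sr v);
  tg_tn : forall u v, tg (tn u v) = tn (tg u) (tg v);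
  tn_hc : forall u u' v v', cd u = dm u' -> cd v = dm v' ->
    tn (hc u u') (hc v v') = hc (tn u v) (tn u' v')
}.

Arguments hc {c} u v : rename.
Arguments vc {c} u v : rename.
Arguments tn {c} u v : rename.
Arguments dm {c} u : rename.
Arguments cd {c} u : rename.
Arguments sr {c} u : rename.
Arguments tg {c} u : rename.
Arguments un {c}.

Declare Scope cell_scope.
Local Open Scope cell_scope.
Local Notation "u :*: v" := (hc u v) (at level 40, left associativity) :
  cell_scope.
Local Notation "u :.: v" := (vc u v) (at level 50, left associativity) :
  cell_scope.
Local Notation "u :x: v" := (tn u v) (at level 39, left associativity) :
  cell_scope.

(* Reverses the 1-cells but not the 2-cells; it exchanges
   [nabla] and [delta]. *)
Definition flip (E : cellAlg) : cellAlg :=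
  @CellAlg E (fun u v => v :*: u) vc tn cd dm sr tg un
    (fun u v w => esym (hcA w v u)) (@hc_cd E) (@hc_dm E)
    (@cd_cd E) (@dm_cd E) (@cd_dm E) (@dm_dm E)
    (fun u v e => cd_hc (esym e)) (fun u v e => dm_hc (esym e))
    (@vc_sr E) (@vc_tg E) (@tg_sr E) (@sr_tg E) (@sr_vc E) (@tg_vc E)
    (@cd_sr E) (@dm_sr E) (@sr_cd E) (@sr_dm E)
    (fun u v => sr_hc v u) (fun u v => tg_hc v u)
    (fun u u' v v' e e' => hc_vc e' e)
    (@tnA E) (@tn1u E) (@tnu1 E)
      (etrans (congr1 cd (esym (dm_un E))) (etrans (cd_dm un) (dm_un E)))
    (@cd_tn E) (@dm_tn E) (@sr_tn E) (@tg_tn E)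
    (fun u u' v v' e e' => tn_hc (esym e) (esym e')).

(** * Interchange laws and adjunctions with identity counit *)

Section CellAlgTheory.
Variable E : cellAlg.
Implicit Types u v w f g : E.

Lemma cd_un : cd (un : E) = un.
Proof. exact: dm_un (flip E). Qed.

Lemma sr_tg1 f : sr f = f -> tg f = f.
Proof. by move=> <-; rewrite tg_sr. Qed.

Lemma tn_dm x u v : dm x = x -> cd u = dm v ->
  x :x: (u :*: v) = (x :x: u) :*: (x :x: v).
Proof.
move=> ex euv; rewrite -tn_hc //; last by rewrite -ex cd_dm dm_dm.
by rewrite -{2}ex hc_dm.
Qed.

Lemma tn_cd x u v : dm x = x -> cd u = dm v ->
  (u :*: v) :x: x = (u :x: x) :*: (v :x: x).
Proof.
move=> ex euv; rewrite -tn_hc //; last by rewrite -ex cd_dm dm_dm.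
by rewrite -{2}ex hc_dm.
Qed.

Lemma tn_lr u v : (u :x: dm v) :*: (cd u :x: v) = u :x: v.
Proof. by rewrite -tn_hc ?hc_cd ?hc_dm // ?dm_cd ?cd_dm. Qed.

Lemma tn_rl u v : (dm u :x: v) :*: (u :x: cd v) = u :x: v.
Proof. by rewrite -tn_hc ?hc_cd ?hc_dm // ?dm_cd ?cd_dm. Qed.

Lemma vc_idem f : sr f = f -> f :.: f = f.
Proof. by move=> e; rewrite -{1}e vc_sr. Qed.

Lemma hc_lr u v : (u :*: sr v) :.: (tg u :*: v) = u :*: v.
Proof. by rewrite -hc_vc ?sr_tg ?tg_sr // vc_tg vc_sr. Qed.

Lemma hc_rl u v : (sr u :*: v) :.: (u :*: tg v) = u :*: v.
Proof. by rewrite -hc_vc ?sr_tg ?tg_sr // vc_tg vc_sr. Qed.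

Lemma hcx_vc f u v : sr f = f -> tg u = sr v ->
  f :*: (u :.: v) = (f :*: u) :.: (f :*: v).
Proof. by move=> ef e; rewrite -hc_vc ?vc_idem // sr_tg1. Qed.

Lemma vc_hcx f u v : sr f = f -> tg u = sr v ->
  (u :.: v) :*: f = (u :*: f) :.: (v :*: f).
Proof. by move=> ef e; rewrite -hc_vc ?vc_idem // sr_tg1. Qed.

(* [S] is left adjoint to [T], with unit [H] and identity counit. *)
Record reflection (S T H : E) : Prop := Reflection {
  refl_srS : sr S = S;
  refl_srT : sr T = T;
  refl_cdS : cd S = dm T;
  refl_cdT : cd T = dm S;
  refl_TS : T :*: S = cd S;
  refl_srH : sr H = dm S;
  refl_tgH : tg H = S :*: T;
  refl_HS : H :*: S = S;
  refl_TH : T :*: H = T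
}.

Lemma refl_dmH S T H : reflection S T H -> dm H = dm S.
Proof. by move=> r; rewrite -dm_sr (refl_srH r) dm_dm. Qed.

Lemma refl_cdH S T H : reflection S T H -> cd H = dm S.
Proof. by move=> r; rewrite -cd_sr (refl_srH r) cd_dm. Qed.

(* In each of the two exchange orders of [H :*: H'] one factor is trivial. *)
Lemma reflection_unique S T H H' :
  reflection S T H -> reflection S T H' -> H = H'.
Proof.
move=> r r'; have := hc_lr H H'; rewrite -(hc_rl H H').
have -> : H :*: sr H' = H by rewrite (refl_srH r') -(refl_cdH r) hc_cd.
have -> : tg H :*: H' = tg H by rewrite (refl_tgH r) -hcA (refl_TH r').
have -> : sr H :*: H' = H' by rewrite (refl_srH r) -(refl_dmH r') hc_dm.
have -> : H :*: tg H' = tg H' by rewrite (refl_tgH r') hcA (refl_HS r).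
by rewrite !vc_tg.
Qed.

Lemma reflection_id x : dm x = x -> reflection x x x.
Proof.
move=> e; have ecd : cd x = x by rewrite -e cd_dm.
have exx : x :*: x = x by rewrite -{1}e hc_dm.
have es : sr x = x by rewrite -e sr_dm.
by split; rewrite ?exx ?ecd ?e ?es ?(sr_tg1 es).
Qed.

(** The usual composite of adjunctions: inside the triangle identities the factor [T :*: S] is an
    identity, so [H] and [H'] are absorbed one after the other. *)
Lemma reflection_hc S T H S' T' H' : cd S = dm S' ->
  reflection S T H -> reflection S' T' H' ->
  reflection (S :*: S') (T' :*: T) (H :.: (S :*: H' :*: T)).
Proof.
move=> e r r'.
have eT : cd T' = dm T by rewrite (refl_cdT r') -e (refl_cdS r).
have eH : tg H = sr (S :*: H' :*: T).
  rewrite !sr_hc (refl_srH r') (refl_srS r) (refl_srT r) (refl_tgH r).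
  by rewrite -e hc_cd.
split.
- by rewrite sr_hc (refl_srS r) (refl_srS r').
- by rewrite sr_hc (refl_srT r) (refl_srT r').
- by rewrite cd_hc // dm_hc // (refl_cdS r').
- by rewrite cd_hc // dm_hc // (refl_cdT r).
- by rewrite -hcA (hcA T) (refl_TS r) e hc_dm (refl_TS r') cd_hc //.
- by rewrite sr_vc // (refl_srH r) dm_hc.
- rewrite tg_vc // !tg_hc (refl_tgH r') !hcA.
  by rewrite (sr_tg1 (refl_srS r)) (sr_tg1 (refl_srT r)).
- rewrite vc_hcx //; last by rewrite sr_hc (refl_srS r) (refl_srS r').
  rewrite hcA (refl_HS r) -(hcA _ T) (hcA T) (refl_TS r) e hc_dm.
  by rewrite -hcA (refl_HS r') vc_idem // sr_hc (refl_srS r) (refl_srS r').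
- rewrite hcx_vc //; last by rewrite sr_hc (refl_srT r) (refl_srT r').
  rewrite -hcA (refl_TH r) !hcA -(hcA T') (refl_TS r) e -(refl_cdT r') hc_cd.
  by rewrite (refl_TH r') vc_idem // sr_hc (refl_srT r) (refl_srT r').
Qed.

Lemma reflection_tn S T H S' T' H' :
  reflection S T H -> reflection S' T' H' ->
  reflection (S :x: S') (T :x: T') (H :x: H').
Proof.
move=> r r'; split.
- by rewrite sr_tn (refl_srS r) (refl_srS r').
- by rewrite sr_tn (refl_srT r) (refl_srT r').
- by rewrite cd_tn dm_tn (refl_cdS r) (refl_cdS r').
- by rewrite cd_tn dm_tn (refl_cdT r) (refl_cdT r').
- by rewrite -tn_hc ?(refl_cdT r) ?(refl_cdT r') // (refl_TS r) (refl_TS r')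
  cd_tn.
- by rewrite sr_tn dm_tn (refl_srH r) (refl_srH r').
- by rewrite tg_tn (refl_tgH r) (refl_tgH r') tn_hc ?(refl_cdS r)
  ?(refl_cdS r').
- by rewrite -tn_hc ?(refl_cdH r) ?(refl_cdH r') // (refl_HS r) (refl_HS r').
- rewrite -tn_hc ?(refl_cdT r) ?(refl_cdT r') ?(refl_dmH r) ?(refl_dmH r') //.
  by rewrite (refl_TH r) (refl_TH r').
Qed.

(* Intended for [(p', S')] a pushout of [(S, p)]. *)
Lemma reflection_slide S T H S' T' H' p p_ K p' p'_ :
  reflection S T H -> reflection S' T' H' -> reflection p p_ K ->
  dm S = dm p -> dm S' = cd p ->
  S :*: p' = p :*: S' -> p'_ :*: T = T' :*: p_ -> T :*: p = p' :*: T' ->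
  H :*: p = p :*: H'.
Proof.
move=> r r' rp e1 e2 eS eT BC.
have Hp_tg : tg (H :*: p) = p :*: (S' :*: T').
  rewrite tg_hc (refl_tgH r) (sr_tg1 (refl_srS rp)) -hcA BC hcA eS.
  by rewrite hcA.
(* Exchanging [K] with [H :*: p] in both orders gives [H :*: p = p :*: (p_ :*: (H :*: p))], because
   [K] is absorbed by [p]. It remains to identify the cell in parentheses. *)
suff <- : p_ :*: (H :*: p) = H'.
  have := hc_lr K (H :*: p); rewrite -(hc_rl K (H :*: p)).
  have -> : K :*: sr (H :*: p) = p.
    by rewrite sr_hc (refl_srH r) (refl_srS rp) e1 hc_dm (refl_HS rp).
  have -> : sr K :*: (H :*: p) = H :*: p.
    by rewrite (refl_srH rp) -e1 hcA -(refl_dmH r) hc_dm.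
  have -> : K :*: tg (H :*: p) = tg (H :*: p) by rewrite Hp_tg hcA (refl_HS rp).
  rewrite vc_tg (refl_tgH rp) => E1; rewrite -[LHS]E1 -hcA.
  have es : sr (p :*: (p_ :*: (H :*: p))) = p.
    rewrite !sr_hc (refl_srS rp) (refl_srT rp) (refl_srH r) e1 hc_dm.
    by rewrite (refl_TS rp) hc_cd.
  by rewrite -{1}es vc_sr.
(* [p_ :*: (H :*: p)] is a unit for [S'] and [T']: [eS] and [eT] move the triangle identities to [S]
   and [T], where [H] is absorbed, and [p_ :*: p] cancels. *)
apply: reflection_unique (r'); split; try by case: r'.
- rewrite !sr_hc (refl_srH r) (refl_srS rp) (refl_srT rp) e1 hc_dm.
  by rewrite (refl_TS rp) e2.
- rewrite tg_hc Hp_tg (sr_tg1 (refl_srT rp)) hcA (refl_TS rp).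
  by rewrite hcA -e2 hc_dm.
- rewrite -!hcA -eS (hcA H) (refl_HS r) eS hcA (refl_TS rp) -e2.
  by rewrite hc_dm.
- rewrite !hcA -eT -(hcA p'_) (refl_TH r) eT -hcA (refl_TS rp) -e2.
  by rewrite -(refl_cdT r') hc_cd.
Qed.

End CellAlgTheory.

(** * Composites of multiplications indexed by words *)

(** The tensor is associative on all of [E], so the Frobenius laws compose here without a
    transport. *)
Record comoCells (E : cellAlg) := ComoCells {
  cob : E;
  cnab : E;
  cdel : E;
  ceta : E;
  dm_cob : dm cob = cob;
  dm_cnab : dm cnab = cob :x: cob;
  cd_cnab : cd cnab = cob;
  dm_cdel : dm cdel = cob;
  cd_cdel : cd cdel = cob :x: cob;
  sr_cnab : sr cnab = cnab;
  sr_cdel : sr cdel = cdel;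
  sr_ceta : sr ceta = cob :x: cob;
  tg_ceta : tg ceta = cnab :*: cdel;
  cnabA : (cnab :x: cob) :*: cnab = (cob :x: cnab) :*: cnab;
  cdelA : cdel :*: (cdel :x: cob) = cdel :*: (cob :x: cdel);
  csep : cdel :*: cnab = cob;
  cfrobl : (cdel :x: cob) :*: (cob :x: cnab) = cnab :*: cdel;
  cfrobr : (cob :x: cdel) :*: (cnab :x: cob) = cnab :*: cdel;
  ceta_nab : ceta :*: cnab = cnab;
  cdel_eta : cdel :*: ceta = cdel
}.

(** The axioms are self-dual: associativity and coassociativity, the two Frobenius laws, and the two
    conditions on [ceta] trade places. Each result on multiplications thus yields its dual. *)
Definition flip_como (E : cellAlg) (A : comoCells E) : comoCells (flip E) :=
  @ComoCells (flip E) (cob A) (cdel A) (cnab A) (ceta A)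
    (etrans (congr1 cd (esym (dm_cob A))) (etrans (cd_dm _) (dm_cob A)))
    (cd_cdel A) (dm_cdel A) (cd_cnab A) (dm_cnab A) (sr_cdel A) (sr_cnab A)
    (sr_ceta A) (tg_ceta A) (cdelA A) (cnabA A) (csep A) (cfrobr A) (cfrobl A)
    (cdel_eta A) (ceta_nab A).

Section Words.
Variables (E : cellAlg) (A : comoCells E).
Local Notation d := (cob A).
Local Notation nab := (cnab A).
Local Notation del := (cdel A).
Local Notation eta := (ceta A).

Fixpoint pw (n : nat) : E := if n is n'.+1 then d :x: pw n' else un.

(* [b] tells, for each two consecutive inputs, whether they are merged; the
   empty word stands for the identity of one strand. *)
Fixpoint Sw (b : bitseq) : E :=
  match b with
  | [::] => d
  | true :: b' => (d :x: Sw b') :*: (nab :x: pw (count negb b'))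
  | false :: b' => d :x: Sw b'
  end.

Lemma cd_cob : cd d = d.
Proof. by rewrite -(dm_cob A) cd_dm. Qed.

Lemma sr_cob : sr d = d.
Proof. by rewrite -(dm_cob A) sr_dm. Qed.

Lemma pwD m n : pw (m + n) = pw m :x: pw n.
Proof. by elim: m => [|m IHm] /=; rewrite ?tn1u // IHm tnA. Qed.

Lemma dm_pw n : dm (pw n) = pw n.
Proof. by elim: n => [|n IHn] /=; rewrite ?dm_un // dm_tn dm_cob IHn. Qed.

Lemma cd_pw n : cd (pw n) = pw n.
Proof. by rewrite -dm_pw cd_dm. Qed.

Lemma sr_pw n : sr (pw n) = pw n.
Proof. by rewrite -dm_pw sr_dm. Qed.

Lemma Sw_typed b :
  [/\ dm (Sw b) = d :x: pw (size b), cd (Sw b) = d :x: pw (count negb b)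
    & sr (Sw b) = Sw b].
Proof.
elim: b => [|[] b [IHd IHc IHs]] /=; rewrite ?tnu1.
- by rewrite dm_cob cd_cob sr_cob.
- have e : cd (d :x: Sw b) = dm (nab :x: pw (count negb b)).
    by rewrite cd_tn dm_tn cd_cob IHc dm_cnab dm_pw tnA.
  rewrite dm_hc // cd_hc // dm_tn dm_cob IHd cd_tn cd_cnab cd_pw.
  by rewrite sr_hc !sr_tn sr_cob IHs sr_cnab sr_pw.
- by rewrite dm_tn cd_tn sr_tn dm_cob cd_cob sr_cob IHd IHc IHs.
Qed.

Lemma dm_Sw b : dm (Sw b) = d :x: pw (size b).
Proof. by case: (Sw_typed b). Qed.

Lemma cd_Sw b : cd (Sw b) = d :x: pw (count negb b).
Proof. by case: (Sw_typed b). Qed.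

Lemma sr_Sw b : sr (Sw b) = Sw b.
Proof. by case: (Sw_typed b). Qed.

End Words.

Ltac bdry := by rewrite ?(dm_tn, cd_tn, dm_pw, cd_pw, dm_cob, cd_cob, dm_Sw,
  cd_Sw, dm_cnab, cd_cnab, dm_cdel, cd_cdel, tnA, tnu1, tn1u).

Section WordTheory.
Variables (E : cellAlg) (A : comoCells E).
Local Notation d := (cob A).
Local Notation nab := (cnab A).
Local Notation del := (cdel A).
Local Notation pw := (pw A).
Local Notation Sw := (Sw A).

Lemma tn_cob u v : cd u = dm v -> d :x: (u :*: v) = (d :x: u) :*: (d :x: v).
Proof. by move=> e; rewrite tn_dm ?dm_cob. Qed.

Lemma tn_pw n u v : cd u = dm v ->
  (u :*: v) :x: pw n = (u :x: pw n) :*: (v :x: pw n).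
Proof. by move=> e; rewrite tn_cd ?dm_pw. Qed.

Implicit Types u v x y : E.

Lemma tn_swap x y u v : cd u = x -> dm v = y ->
  (u :x: y) :*: (x :x: v) = (dm u :x: v) :*: (u :x: cd v).
Proof. by move=> <- <-; rewrite tn_lr tn_rl. Qed.

(** Only the first letter of [b] matters: a merge there is handled by associativity, a gap by
    interchange. *)
Lemma nab_Sw b :
  (nab :x: pw (size b)) :*: Sw b = (d :x: Sw b) :*: (nab :x: pw (count negb b)).
Proof.
case: b => [|[] b] /=; rewrite ?add0n.
- rewrite !tnu1 -{1}(cd_cnab A) hc_cd -[in RHS](dm_cnab A) hc_dm //.
- rewrite tn_cob; last by bdry.
  rewrite hcA tn_swap ?dm_Sw ?cd_cnab // dm_cnab cd_Sw -hcA tnA -tn_pw;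
    last by bdry.
  by rewrite cnabA tn_pw ?hcA ?tnA //; bdry.
- by rewrite tn_swap ?dm_Sw ?cd_cnab // dm_cnab cd_Sw !tnA.
Qed.

(** As for [nab_Sw], with the Frobenius law in place of associativity. *)
Lemma del_Sw b :
  (del :x: pw (size b)) :*: (d :x: Sw b) = Sw b :*: (del :x: pw (count negb b)).
Proof.
case: b => [|[] b] /=; rewrite ?add0n.
- by rewrite !tnu1 -{1}(cd_cdel A) hc_cd -[in RHS](dm_cdel A) hc_dm.
- rewrite tn_cob; last by bdry.
  rewrite hcA [d :x: (d :x: _)]tnA tn_swap ?dm_Sw ?cd_cdel // dm_cdel cd_Sw.
  by rewrite -!hcA !tnA -!tn_pw ?cfrobl //; bdry.
- by rewrite [d :x: (d :x: _)]tnA tn_swap ?dm_Sw ?cd_cdel // dm_cdel cd_Sw.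
Qed.

(** The letter [false] at the junction keeps the two blocks of strands apart. *)
Lemma Sw_cat b c : Sw (b ++ false :: c) = Sw b :x: Sw c.
Proof.
elim: b => [|[] b IHb] //=; rewrite {}IHb ?tnA // -[in RHS](hc_cd (Sw c)) tn_hc.
- by rewrite cd_Sw count_cat pwD !tnA.
- by bdry.
- by rewrite dm_cd.
Qed.

Lemma Sw_nseq n : Sw (nseq n false) = pw n.+1.
Proof. by elim: n => [|n /= ->] //=; rewrite tnu1. Qed.

Lemma size_mask_negb f (h : bitseq) :
  size f = size h -> size (mask (map negb f) h) = count negb f.
Proof. by move=> eq_s; rewrite size_mask ?size_map // count_map;
  apply: eq_count. Qed.

Lemma count_mask_negb f h : size f = size h -> all2 implb f h ->
  count negb (mask (map negb f) h) = count negb h.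
Proof. by elim: f h => [|[] f IHf] [|[] h] //= [/IHf IH] /IH <-. Qed.

(** Functoriality for words. The gaps left after merging by [f] are its [false] positions, so the
    mask is the part of [h] still to be merged; when both words begin with a merge, [nab_Sw]
    postpones the one of [f]. *)
Lemma Sw_mask f h : size f = size h -> all2 implb f h ->
  Sw f :*: Sw (mask (map negb f) h) = Sw h.
Proof.
elim: f h => [|b f IHf] [|c h] //=.
  by move=> _ _; rewrite -{1}(dm_cob A) hc_dm.
move=> [eq_s] /andP[le_bc le_fh]; rewrite -(IHf h) // tn_cob; last first.
  by rewrite cd_Sw dm_Sw size_mask_negb.
case: b c le_bc => [] [] //= _.
- by rewrite -hcA -(size_mask_negb eq_s) nab_Sw count_mask_negb // hcA.
- by rewrite hcA count_mask_negb.
Qed.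

End WordTheory.

(** Taken in the flipped algebra, so that facts on [Sw] become facts on [Tw] by conversion. *)
Definition Tw (E : cellAlg) (A : comoCells E) : bitseq -> E :=
  @Sw (flip E) (flip_como A).

Arguments Tw : simpl never.

(** * Dual words, units, and the Beck-Chevalley identity for words *)

Section Duals.
Variables (E : cellAlg) (A : comoCells E).
Local Notation d := (cob A).
Local Notation nab := (cnab A).
Local Notation del := (cdel A).
Local Notation eta := (ceta A).
Local Notation pw := (pw A).
Local Notation Sw := (Sw A).

Local Notation Tw := (Tw A).

Lemma Tw_true b : Tw (true :: b) = (del :x: pw (count negb b)) :*: (d :x: Tw b).
Proof. by []. Qed.

Lemma Tw_false b : Tw (false :: b) = d :x: Tw b.
Proof. by []. Qed.

Lemma dm_Tw b : dm (Tw b) = d :x: pw (count negb b).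
Proof. exact: cd_Sw (flip_como A) b. Qed.

Lemma cd_Tw b : cd (Tw b) = d :x: pw (size b).
Proof. exact: dm_Sw (flip_como A) b. Qed.

Lemma sr_Tw b : sr (Tw b) = Tw b.
Proof. exact: sr_Sw (flip_como A) b. Qed.

Lemma nab_Tw b :
  (d :x: Tw b) :*: (nab :x: pw (size b)) = (nab :x: pw (count negb b)) :*: Tw b.
Proof. exact: del_Sw (flip_como A) b. Qed.

Lemma reflection_nab : reflection nab del eta.
Proof.
split; rewrite ?sr_cnab ?sr_cdel ?cd_cnab ?dm_cdel ?cd_cdel ?dm_cnab //.
- exact: csep.
- exact: sr_ceta.
- exact: tg_ceta.
- exact: ceta_nab.
- exact: cdel_eta.
Qed.

(** The merging case is the unit that [reflection_hc] builds from the two tensored reflections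
    composed in [Sw]. *)
Fixpoint Hw (b : bitseq) : E :=
  match b with
  | [::] => d
  | true :: b' => (d :x: Hw b') :.:
      ((d :x: Sw b') :*: (eta :x: pw (count negb b')) :*: (d :x: Tw b'))
  | false :: b' => d :x: Hw b'
  end.

Lemma reflection_w b : reflection (Sw b) (Tw b) (Hw b).
Proof.
have rd := reflection_id (dm_cob A).
elim: b => [|[] b IHb] //=; last exact: reflection_tn.
apply: reflection_hc (reflection_tn rd IHb) (reflection_tn reflection_nab _).
  by bdry.
exact: reflection_id (dm_pw _ _).
Qed.

(** The word of the diagonal of a pushout: neighbours are merged as soon as one of the two legs
    merges them (see [bits_po]). *)
Definition orw (f g : bitseq) : bitseq := [seq p.1 || p.2 | p <- zip f g].

Lemma Tw_Sw f g : size f = size g ->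
  Tw f :*: Sw g =
  Sw (mask (map negb f) (orw f g)) :*: Tw (mask (map negb g) (orw f g)).
Proof.
elim: f g => [|b f IHf] [|c g] //= [eq_s].
have /(_ f g eq_s) szo : forall f g, size f = size g -> size f = size (orw f g).
  by move=> x y e; rewrite size_map size_zip -e minnn.
have szp := size_mask_negb szo;
  have szq := size_mask_negb (etrans (esym eq_s) szo).
have kp : count negb (mask (map negb f) (orw f g)) = count negb (orw f g).
  apply: count_mask_negb => //; rewrite /orw.
  by elim: (f) (g) eq_s => [|[] f' IH] [|[] g'] //= [/IH].
have kq : count negb (mask (map negb g) (orw f g)) = count negb (orw f g).
  apply: count_mask_negb; rewrite -?eq_s // /orw.
  by elim: (f) (g) eq_s => [|[] f' IH] [|[] g'] //= [/IH].
have kpq := etrans kp (esym kq).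
have {}IHf := IHf g eq_s.
rewrite -/(orw f g).
set p := mask _ _ in IHf szp kp kpq *; set q := mask _ _ in IHf szq kq kpq *.
have eTS : cd (Tw f) = dm (Sw g) by rewrite cd_Tw dm_Sw eq_s.
have eST : cd (Sw p) = dm (Tw q) by rewrite cd_Sw dm_Tw kpq.
have {}IHf : (d :x: Tw f) :*: (d :x: Sw g) = (d :x: Sw p) :*: (d :x: Tw q).
  by rewrite -!tn_cob // IHf.
(* If both words merge, [del_Sw] and [nab_Tw] bring [del] next to [nab], and separability cancels
   them. If only one merges, one of these slides suffices; if none does, a strand is tensored on. *)
case: b c => [] [] /=.
- rewrite Tw_true -hcA (hcA (d :x: Tw f)) IHf !hcA -szp del_Sw -!hcA.
  rewrite -szq nab_Tw (hcA (del :x: _)) kpq -tn_pw ?csep; last by bdry.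
  by rewrite -dm_Tw hc_dm.
- by rewrite !Tw_true -hcA IHf hcA -szp del_Sw -!hcA kpq.
- by rewrite hcA IHf -hcA -szq nab_Tw hcA kpq.
- by rewrite !Tw_false IHf.
Qed.

End Duals.

(** * Monotone surjections *)

(** A deleted entry equals its predecessor, hence so do their images under [h], and the remaining
    comparisons are unchanged. *)
Lemma mask_pairmap (h : nat -> nat) v s :
  mask (map negb (pairmap eq_op v s)) (pairmap eq_op (h v) (map h s)) =
  pairmap eq_op (h v) (map h (mask (map negb (pairmap eq_op v s)) s)).
Proof. by elim: s v => //= w s IHs v; case: eqVneq => [->|_] /=;
  rewrite IHs. Qed.

Lemma pairmap_implb (h : nat -> nat) v s :
  all2 implb (pairmap eq_op v s) (pairmap eq_op (h v) (map h s)).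
Proof.
elim: s v => //= w s IHs v; rewrite IHs andbT.
by apply/implyP => /eqP ->.
Qed.

(** In a sorted list equal entries are adjacent, so removing duplicates keeps the entries that
    differ from their predecessor. *)
Lemma undup_path v s : path leq v s ->
  undup (v :: s) = v :: mask (map negb (pairmap eq_op v s)) s.
Proof.
elim: s v => // w s IHs v /= /andP[le_vw pw].
have {}IHs : undup (w :: s) = _ := IHs _ pw.
rewrite -[if w \in s then _ else _]/(undup (w :: s)) inE IHs.
have [->|ne_vw] //= := eqVneq v w.
case: ifP => // v_s; have := order_path_min leq_trans pw => /allP/(_ _ v_s)
  le_wv.
by case/eqP: ne_vw; apply/eqP; rewrite eqn_leq le_vw.
Qed.

Definition code n m (f : sLin n m) : seq nat :=
  [seq val (f i) | i <- enum 'I_n].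

(** The word in the sense of [Sw]: bit [i] tells whether [f] identifies [i] and [i.+1]. Sources 0
    and 1 both give the empty word. *)
Definition bits n m (f : sLin n m) : bitseq :=
  if code f is v :: s then pairmap eq_op v s else [::].

Section Code.
Variables (n m : nat).
Implicit Type f : sLin n m.

Lemma size_code f : size (code f) = n.
Proof. by rewrite size_map size_enum_ord. Qed.

Lemma nth_code f (i : 'I_n) : nth 0 (code f) i = f i.
Proof. by rewrite (nth_map i) ?size_enum_ord // nth_ord_enum. Qed.

Lemma code_sorted f : sorted leq (code f).
Proof.
apply: (homo_sorted (e := relpre val leq)).
  by move=> i j; apply: sLin_mono.
by rewrite -sorted_map val_enum_ord iota_sorted.
Qed.

Lemma undup_code f : undup (code f) = iota 0 m.
Proof.
apply: (irr_sorted_eq ltn_trans ltnn).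
- rewrite ltn_sorted_uniq_leq undup_uniq.
  exact: (subseq_sorted leq_trans (undup_subseq _) (code_sorted f)).
- exact: iota_ltn_sorted.
move=> k; rewrite mem_undup mem_iota add0n /=;
  apply/mapP/idP => [[i _ ->]|lt_km]; first exact: ltn_ord.
by have [i /eqP fi] := sLin_surj f (Ordinal lt_km); exists i;
  rewrite ?mem_enum ?fi.
Qed.

Lemma size_bits f : size (bits f) = n.-1.
Proof.
by rewrite -[in RHS](size_code f) /bits; case: (code f) => //= v s;
  rewrite size_pairmap.
Qed.

Lemma nth_bits f (i j : 'I_n) : j = i.+1 :> nat ->
  nth false (bits f) i = (f i == f j).
Proof.
move=> ij; rewrite -val_eqE /= -!nth_code ij /bits.
have := ltn_ord j; rewrite ij -[X in _ < X](size_code f).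
by case: (code f) => //= v s lt_i; rewrite (nth_pairmap 0).
Qed.

End Code.

(** Surjectivity makes the values start at 0, and each [false] bit marks the first occurrence of the
    next value. *)
Lemma code_bits n m (f : sLin n.+1 m) :
  [/\ code f = 0 :: behead (code f),
      bits f = pairmap eq_op 0 (behead (code f)) &
      0 :: mask (map negb (bits f)) (behead (code f)) = iota 0 m].
Proof.
have := undup_code f; have := code_sorted f; have := size_code f; rewrite /bits.
case: (code f) => // v s _ p; rewrite (undup_path p) /=.
by case: m f => //= m f [-> <-].
Qed.

Lemma count_bits n m (f : sLin n.+1 m) : (count negb (bits f)).+1 = m.
Proof.
have [_ eb /(congr1 size)] := code_bits f; rewrite size_iota; apply: etrans.
rewrite /= size_mask; last by rewrite size_map size_bits size_behead size_code.
by rewrite count_map; congr _.+1; apply: eq_count.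
Qed.

Lemma code_sid n : code (sid n) = iota 0 n.
Proof.
by rewrite -val_enum_ord; apply: eq_map => i; rewrite sidE.
Qed.

Lemma code_scomp n m p (f : sLin n m) (g : sLin m p) :
  code (scomp f g) = map (nth 0 (code g)) (code f).
Proof. by rewrite -map_comp; apply: eq_map => i /=;
  rewrite scompE nth_code. Qed.

Lemma code_sadd n m n' m' (f : sLin n m) (f' : sLin n' m') :
  code (sadd f f') = code f ++ map (addn m) (code f').
Proof.
apply: (@eq_from_nth _ 0) => [|i];
  first by rewrite size_cat size_map !size_code.
rewrite size_code => lt_i; rewrite -[i in LHS]/(val (Ordinal lt_i)) nth_code.
rewrite nth_cat size_code; case: (split_ordP (Ordinal lt_i)) => j ei.
  rewrite ei sadd_lshift; have -> : i = j by case: ei.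
  by rewrite nth_code.
rewrite ei sadd_rshift; have -> : i = n + j by case: ei.
by rewrite addKn (nth_map 0) ?size_code // nth_code.
Qed.

Lemma bits_sid n : bits (sid n) = nseq n.-1 false.
Proof.
rewrite /bits code_sid; case: n => //= n.
by elim: n 0 => //= n IHn k; rewrite IHn -{1}[k]addn0 -addn1 eqn_add2l.
Qed.

(** Supplies the hypotheses of [Sw_mask]: dropping repetitions from the values of [f] leaves
    [iota 0 m], on which the composite reads off [g]. *)
Lemma bits_scomp n m p (f : sLin n.+1 m) (g : sLin m p) :
  mask (map negb (bits f)) (bits (scomp f g)) = bits g /\
  all2 implb (bits f) (bits (scomp f g)).
Proof.
have [ec eb em] := code_bits f.
have ecg : code g = map (nth 0 (code g)) (iota 0 m).
  by rewrite map_nth_iota0 ?size_code // -[X in take X](size_code g) take_size.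
have -> : bits (scomp f g) =
    pairmap eq_op (nth 0 (code g) 0) (map (nth 0 (code g)) (behead (code f))).
  by rewrite /bits code_scomp ec.
rewrite eb; split; last exact: pairmap_implb.
by rewrite mask_pairmap -[in LHS]eb [RHS]/bits [in RHS]ecg -em.
Qed.

Lemma bits_sadd n m n' m' (f : sLin n.+1 m) (f' : sLin n'.+1 m') :
  bits (sadd f f') = bits f ++ false :: bits f'.
Proof.
have [ec eb _] := code_bits f; have [ec' eb' _] := code_bits f'.
rewrite {1}/bits code_sadd ec ec' /= pairmap_cat -eb /= addn0;
  congr (_ ++ _ :: _).
  (* The junction bit is [false]: the first block ends with a value of [f], which is below [m], and
     the second starts at [m]. *)
  have : last 0 (behead (code f)) \in code f by rewrite {2}ec mem_last.
  case/mapP => i _ ->; apply/eqP => e.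
  by have := ltn_ord (f i); rewrite -[X in _ < X]e ltnn.
rewrite eb' -{1}[m]addn0; elim: (behead _) 0 => //= w s IHs v.
by rewrite eqn_add2l IHs.
Qed.

(** * Values of surjections in an arbitrary Como-algebra *)

Section Values.
Variables (E : cellAlg) (A : comoCells E).

(** Source 0 is treated apart because the empty word stands for one strand, not for none. *)
Definition Sf n m (f : sLin n m) : E := if n is 0 then un else Sw A (bits f).
Definition Tf n m (f : sLin n m) : E := if n is 0 then un else Tw A (bits f).
Definition Hf n m (f : sLin n m) : E := if n is 0 then un else Hw A (bits f).

Lemma sLin0 m (f : sLin 0 m) : m = 0.
Proof. by case: m f => // m /sLin_leq. Qed.

Lemma reflection_f n m (f : sLin n m) : reflection (Sf f) (Tf f) (Hf f).
Proof. by case: n f => [|n] f;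
  [apply/reflection_id/dm_un | apply: reflection_w]. Qed.

Lemma dm_Sf n m (f : sLin n m) : dm (Sf f) = pw A n.
Proof. by case: n f => [|n] f; rewrite /Sf ?dm_un // dm_Sw size_bits. Qed.

Lemma cd_Sf n m (f : sLin n m) : cd (Sf f) = pw A m.
Proof.
case: n f => [|n] f; first by rewrite /Sf cd_un (sLin0 f).
by rewrite /Sf cd_Sw -[in RHS](count_bits f).
Qed.

Lemma Sf_sid n : Sf (sid n) = pw A n.
Proof. by case: n => // n; rewrite /Sf bits_sid Sw_nseq. Qed.

Lemma Sf_scomp n m p (f : sLin n m) (g : sLin m p) :
  Sf (scomp f g) = Sf f :*: Sf g.
Proof.
case: n f => [|n] f.
  case: m f g => [|m] f g; last by have := sLin_leq f.
  by rewrite /Sf -{2}(dm_un E) hc_dm.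
case: m f g => [|m] f g; first by case: (f ord0).
have [eg le] := bits_scomp f g.
by rewrite /Sf -eg Sw_mask ?size_bits.
Qed.

Lemma Sf_sadd n m n' m' (f : sLin n m) (f' : sLin n' m') :
  Sf (sadd f f') = Sf f :x: Sf f'.
Proof.
case: n f => [|n] f.
  rewrite {2}/Sf tn1u; case: m f => [|m] f; last by have := sLin_leq f.
  case: n' f' => // n' f'; rewrite /Sf /bits code_sadd /=; congr (Sw A _).
  have -> : code f = [::] by apply/size0nil/size_code.
  by rewrite /= map_id.
case: n' f' => [|n'] f'; last by rewrite /Sf /= bits_sadd Sw_cat.
rewrite {3}/Sf tnu1 /Sf /= /bits code_sadd.
have -> : code f' = [::] by apply/size0nil/size_code.
by rewrite cats0.
Qed.
End Values.

(** * Pushouts of surjections and the Beck-Chevalley identity *)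

Lemma sLin_step n m (f : sLin n m) (i j k : 'I_n) : j = i.+1 :> nat ->
  f i != f j -> (f i < f k) = (i < k).
Proof.
move=> ij ne; have [lt_ik|le_ki] := ltnP i k; last by rewrite ltnNge sLin_mono.
apply: (@leq_trans (f j)); last by rewrite sLin_mono // ij.
by rewrite ltn_neqAle val_eqE ne sLin_mono // ij.
Qed.

Lemma bits_po x y z (f : sLin x y) (g : sLin x z) :
  bits (scomp f (po_inl f g)) = orw (bits f) (bits g).
Proof.
have so : size (orw (bits f) (bits g)) = x.-1.
  by rewrite size_map size_zip !size_bits minnn.
apply: (@eq_from_nth _ false) => [|i]; rewrite size_bits ?so // => lt_i.
have lt_i1 : i.+1 < x by rewrite -ltn_predRL.
rewrite (nth_map (false, false)) ?nth_zip ?size_zip ?size_bits ?minnn //=.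
pose i0 := Ordinal (ltnW lt_i1); pose i1 := Ordinal lt_i1.
rewrite -[i]/(val i0) !(@nth_bits _ _ _ i0 i1) //.
apply/eqP/orP => [e|[] /eqP e]; last 2 first.
- by rewrite !scompE e.
- by rewrite po_comm !scompE e.
(* If neither [f] nor [g] identifies [i0] and [i1], then lying beyond [i0] is a property of values
   under [f] and under [g] alike. It therefore descends to the pushout, where it separates the two
   points. *)
apply/orP; rewrite -[_ || _]negbK negb_or; apply/negP => /andP[nf ng].
have uv k : (f i0 < f k) = (g i0 < g k).
  by rewrite !(@sLin_step _ _ _ i0 i1).
rewrite sdescK in e; have := po_diag_ker (u := fun a => f i0 < a)
  (v := fun a => g i0 < a) uv e.
by rewrite ltnn !(@sLin_step _ _ _ i0 i1) //= ltnSn.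
Qed.

Section Pushouts.
Variables (E : cellAlg) (A : comoCells E).

(** By [bits_po] and [bits_scomp], the words of the two injections are the masks that occur in
    [Tw_Sw]. *)
Lemma Tf_Sf_po x y z (f : sLin x y) (g : sLin x z) :
  Tf A f :*: Sf A g = Sf A (po_inl f g) :*: Tf A (po_inr f g).
Proof.
case: x f g => [|x] f g.
  case: y f => [|y] f; last by have := sLin_leq f.
  by case: z g => [|z] g; last by have := sLin_leq g.
case: y f => [|y] f; first by case: (f ord0).
case: z g => [|z] g; first by case: (g ord0).
rewrite /Tf /Sf Tw_Sw ?size_bits // -bits_po.
have [<- _] := bits_scomp f (po_inl f g).
by have [<- _] := bits_scomp g (po_inr f g); rewrite po_comm.
Qed.

Lemma Tf_Sf_pushout x y z p (f : sLin x y) (g : sLin x z) (a : sLin y p)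
    (b : sLin z p) :
  is_pushout f g a b -> Tf A f :*: Sf A g = Sf A a :*: Tf A b.
Proof.
move=> /pushout_unique e; rewrite Tf_Sf_po.
pose F (w : {q & (sLin y q * sLin z q)%type}) := Sf A (projT2 w).1 :*: Tf A
  (projT2 w).2.
exact: esym (congr1 F e).
Qed.

End Pushouts.

Lemma reflection_flip (E : cellAlg) (S T H : E) :
  reflection S T H -> @reflection (flip E) T S H.
Proof.
move=> r; split; rewrite /= ?(refl_srS r) ?(refl_srT r) ?(refl_cdS r)
  ?(refl_cdT r) //.
- by rewrite (refl_TS r) (refl_cdS r).
- exact: refl_srH r.
- exact: refl_tgH r.
- exact: refl_TH r.
- exact: refl_HS r.
Qed.

(** * The assignment on cospans and on their 2-cells *)

Section CospanValues.
Variables (E : cellAlg) (A : comoCells E).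
Local Notation Sf := (Sf A).
Local Notation Tf := (Tf A).
Local Notation Hf := (Hf A).
Local Notation pw := (pw A).

Lemma dm_Tf n m (f : sLin n m) : dm (Tf f) = pw m.
Proof. by rewrite -(refl_cdS (reflection_f A f)) cd_Sf. Qed.

Lemma cd_Tf n m (f : sLin n m) : cd (Tf f) = pw n.
Proof. by rewrite (refl_cdT (reflection_f A f)) dm_Sf. Qed.

Lemma Tf_sid n : Tf (sid n) = pw n.
Proof. exact: Sf_sid (flip_como A) n. Qed.

Lemma Tf_scomp n m p (f : sLin n m) (g : sLin m p) :
  Tf (scomp f g) = Tf g :*: Tf f.
Proof. exact: Sf_scomp (flip_como A) _ _ _ f g. Qed.

Lemma Tf_sadd n m n' m' (f : sLin n m) (f' : sLin n' m') :
  Tf (sadd f f') = Tf f :x: Tf f'.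
Proof. exact: Sf_sadd (flip_como A) _ _ _ _ f f'. Qed.

(** Here and in [Hf_scomp] and [Hf_sadd] both sides are units of one reflection, so
    [reflection_unique] replaces an induction on words. *)
Lemma Hf_sid n : Hf (sid n) = pw n.
Proof.
have := reflection_f A (sid n); rewrite Sf_sid Tf_sid => /reflection_unique;
  apply.
exact/reflection_id/dm_pw.
Qed.

Lemma Hf_scomp n m p (f : sLin n m) (g : sLin m p) :
  Hf (scomp f g) = Hf f :.: (Sf f :*: Hf g :*: Tf f).
Proof.
apply: reflection_unique (reflection_f A _) _; rewrite Sf_scomp Tf_scomp.
by apply: reflection_hc (reflection_f A f) (reflection_f A g);
  rewrite cd_Sf dm_Sf.
Qed.

Lemma Hf_sadd n m n' m' (f : sLin n m) (f' : sLin n' m') :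
  Hf (sadd f f') = Hf f :x: Hf f'.
Proof.
apply: reflection_unique (reflection_f A _) _; rewrite Sf_sadd Tf_sadd.
exact: reflection_tn (reflection_f A f) (reflection_f A f').
Qed.

Lemma is_pushoutC x y z p (f : sLin x y) (g : sLin x z) (a : sLin y p)
    (b : sLin z p) :
  is_pushout f g a b -> is_pushout g f b a.
Proof.
case=> e univ; split=> // k u v /esym uv;
  have [w [[wa wb] wU]] := univ _ _ _ uv.
by exists w; split=> // w' [w'b w'a]; apply: wU.
Qed.

Lemma Hf_slide x y z p (f : sLin x y) (g : sLin x z) (a : sLin y p)
    (b : sLin z p) :
  is_pushout f g a b -> Hf f :*: Sf g = Sf g :*: Hf b.
Proof.
move=> po; have [e _] := po.
apply: (reflection_slide (reflection_f A f) (reflection_f A b)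
  (reflection_f A g) (p' := Sf a) (p'_ := Tf a)).
- by rewrite !dm_Sf.
- by rewrite dm_Sf cd_Sf.
- by rewrite -!Sf_scomp e.
- by rewrite -!Tf_scomp e.
- exact: Tf_Sf_pushout.
Qed.

(** This is [reflection_slide] in the flipped algebra, where the roles of [Sf] and [Tf] are
    exchanged; Beck-Chevalley is then applied to the transposed square. *)
Lemma Hf_slide_op x y z p (f : sLin x y) (g : sLin x z) (a : sLin y p)
    (b : sLin z p) :
  is_pushout f g a b -> Tf g :*: Hf f = Hf b :*: Tf g.
Proof.
move=> po; have [e _] := po.
apply: (@reflection_slide (flip E) _ _ _ _ _ _ _ _ _ (Tf a) (Sf a)
  (reflection_flip (reflection_f A f)) (reflection_flip (reflection_f A b))
  (reflection_flip (reflection_f A g))) => /=.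
- by rewrite !cd_Tf.
- by rewrite cd_Tf dm_Tf.
- by rewrite -!Tf_scomp e.
- by rewrite -!Sf_scomp e.
- exact/Tf_Sf_pushout/is_pushoutC.
Qed.

(** Pushout cancellation. The mediating map comes from the outer rectangle; as surjections are epi,
    its equation on [w] is checked after [j], and uniqueness after [i']. *)
Lemma is_pushout_cancel x y y' z p p' (f : sLin x y) (a : sLin y y')
    (g : sLin x z) (i : sLin y p) (j : sLin z p) (i' : sLin y' p')
    (j' : sLin z p') (w : sLin p p') :
  scomp f i = scomp g j -> is_pushout (scomp f a) g i' j' ->
  scomp i w = scomp a i' -> scomp j w = j' -> is_pushout a i i' w.
Proof.
move=> fg [_ univ] ei ej; split=> [//|k u v uv].
have E1 : scomp (scomp f a) u = scomp g (scomp j v).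
  by rewrite -scompA uv !scompA fg.
have [t [[e1 e2] _]] := univ _ _ _ E1; exists t; split=> [|t' [et' _]].
  by split=> //; apply: (@scomp_epi _ _ _ j); rewrite scompA ej.
by apply: (@scomp_epi _ _ _ i'); rewrite et'.
Qed.

Definition Phi1 x y (c : cospan x y) : E := Sf (legl c) :*: Tf (legr c).
(** The whiskered unit of the underlying map [m]. It ends at [Phi1 d] since the legs of [d] are
    those of [c] followed by [m]. *)
Definition Phi2 x y (c d : cospan x y) (a : cospan_cell c d) : E :=
  Sf (legl c) :*: Hf (cell_map a) :*: Tf (legr c).

Lemma sr_Sf n m (f : sLin n m) : sr (Sf f) = Sf f.
Proof. exact: refl_srS (reflection_f A f). Qed.
Lemma sr_Tf n m (f : sLin n m) : sr (Tf f) = Tf f.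
Proof. exact: refl_srT (reflection_f A f). Qed.

Lemma dm_Phi1 x y (c : cospan x y) : dm (Phi1 c) = pw x.
Proof. by rewrite /Phi1 dm_hc ?cd_Sf ?dm_Tf ?dm_Sf. Qed.

Lemma cd_Phi1 x y (c : cospan x y) : cd (Phi1 c) = pw y.
Proof. by rewrite /Phi1 cd_hc ?cd_Sf ?dm_Tf ?cd_Tf. Qed.

Lemma sr_Phi1 x y (c : cospan x y) : sr (Phi1 c) = Phi1 c.
Proof. by rewrite sr_hc sr_Sf sr_Tf. Qed.

Lemma sr_Phi2 x y (c d : cospan x y) (a : cospan_cell c d) :
  sr (Phi2 a) = Phi1 c.
Proof.
rewrite !sr_hc sr_Sf sr_Tf (refl_srH (reflection_f A _)) dm_Sf.
by rewrite -(cd_Sf A (legl c)) hc_cd.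
Qed.

Lemma tg_Phi2 x y (c d : cospan x y) (a : cospan_cell c d) :
  tg (Phi2 a) = Phi1 d.
Proof.
rewrite !tg_hc (sr_tg1 (sr_Sf _)) (sr_tg1 (sr_Tf _))
  (refl_tgH (reflection_f A _)).
by rewrite -hcA -hcA -Tf_scomp cell_mapr hcA -Sf_scomp cell_mapl.
Qed.

Lemma Phi1_id x : Phi1 (cospan_id x) = pw x.
Proof. by rewrite /Phi1 Sf_sid Tf_sid -{1}(dm_pw A x) hc_dm. Qed.

Lemma Phi1_comp x y z (c : cospan x y) (d : cospan y z) :
  Phi1 (cospan_comp c d) = Phi1 c :*: Phi1 d.
Proof.
by rewrite /Phi1 /= Sf_scomp Tf_scomp -!hcA (hcA (Sf (po_inl _ _))) -Tf_Sf_po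
  -hcA.
Qed.

Lemma Phi1_add x y x' y' (c : cospan x y) (c' : cospan x' y') :
  Phi1 (cospan_add c c') = Phi1 c :x: Phi1 c'.
Proof. by rewrite /Phi1 /= Sf_sadd Tf_sadd tn_hc ?cd_Sf ?dm_Tf. Qed.

Lemma Phi2_id x y (c : cospan x y) : Phi2 (cospan_id2 c) = Phi1 c.
Proof. by rewrite /Phi2 /= Hf_sid -(cd_Sf A (legl c)) hc_cd. Qed.

Lemma Phi2_vcomp x y (c d e : cospan x y) (a : cospan_cell c d)
    (b : cospan_cell d e) :
  Phi2 (cospan_vcomp a b) = Phi2 a :.: Phi2 b.
Proof.
have eab : tg (Phi2 a) = sr (Phi2 b) by rewrite tg_Phi2 sr_Phi2.
have tH : tg (Hf (cell_map a)) =
    sr (Sf (cell_map a) :*: Hf (cell_map b) :*: Tf (cell_map a)).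
  rewrite !sr_hc sr_Sf sr_Tf (refl_tgH (reflection_f A _))
    (refl_srH (reflection_f A _)) dm_Sf.
  by rewrite -(cd_Sf A (cell_map a)) hc_cd.
rewrite /Phi2 /= Hf_scomp hcx_vc ?sr_Sf // vc_hcx ?sr_Tf //; last first.
  by rewrite tg_hc sr_hc tH (sr_tg1 (sr_Sf _)) sr_Sf.
congr (_ :.: _); rewrite -(cell_mapl a) -(cell_mapr a) Sf_scomp Tf_scomp.
by rewrite !hcA.
Qed.

Lemma Phi2_add x y x' y' (c d : cospan x y) (c' d' : cospan x' y')
    (a : cospan_cell c d) (a' : cospan_cell c' d') :
  Phi2 (cospan_add2 a a') = Phi2 a :x: Phi2 a'.
Proof.
have e n m (f : sLin n m) : [/\ dm (Hf f) = pw n & cd (Hf f) = pw n].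
  by rewrite (refl_dmH (reflection_f A f)) (refl_cdH (reflection_f A f)) dm_Sf.
have [[d1 c1] [d2 c2]] := (e _ _ (cell_map a), e _ _ (cell_map a')).
by rewrite /Phi2 /= Sf_sadd Tf_sadd Hf_sadd -!tn_hc ?cd_hc ?cd_Sf ?dm_Tf
  ?c1 ?c2.
Qed.

Lemma Phi2_whiskr x y z (c c' : cospan x y) (d : cospan y z)
    (a : cospan_cell c c') :
  Phi2 (cospan_hcomp a (cospan_id2 d)) = Phi2 a :*: Phi1 d.
Proof.
case: c' a => B g0 g1 [m el /= er]; case: _ / er.
rewrite /Phi2 /Phi1 /= Sf_scomp Tf_scomp; set w := po_rec _.
(* The pushout for the target composite is pasted from the one for the source composite and this
   square, so the map [w] of the whiskered cell is a pushout of [m] and [Hf_slide] applies. *)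
have po : is_pushout m (po_inl (legr c) (legl d))
  (po_inl (scomp (legr c) m) (legl d)) w.
  apply: (is_pushout_cancel (po_comm _ _) (po_is_pushout _ _)).
    exact: po_recl.
  by rewrite po_recr scomp1f.
rewrite -!hcA (hcA (Tf (legr c))) Tf_Sf_po.
by rewrite !hcA -(hcA _ (Hf m)) (Hf_slide po) !hcA.
Qed.

Lemma Phi2_whiskl x y z (c : cospan x y) (d d' : cospan y z)
    (b : cospan_cell d d') :
  Phi2 (cospan_hcomp (cospan_id2 c) b) = Phi1 c :*: Phi2 b.
Proof.
case: d' b => B g0 g1 [m /= el er]; case: _ / el.
rewrite /Phi2 /Phi1 /= Sf_scomp Tf_scomp; set w := po_rec _.
have po : is_pushout m (po_inr (legr c) (legl d))
  (po_inr (legr c) (scomp (legl d) m)) w.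
  apply: (is_pushout_cancel (esym (po_comm _ _))
    (is_pushoutC (po_is_pushout _ _))).
    exact: po_recr.
  by rewrite po_recl scomp1f.
rewrite -!hcA (hcA (Tf (legr c))) Tf_Sf_po.
by rewrite -(hcA _ (Tf _)) (hcA (Tf _) (Hf m)) (Hf_slide_op po) !hcA.
Qed.

(** By interchange a horizontal composite is a vertical composite of two whiskerings. *)
Lemma Phi2_hcomp x y z (c c' : cospan x y) (d d' : cospan y z)
    (a : cospan_cell c c') (b : cospan_cell d d') :
  Phi2 (cospan_hcomp a b) = Phi2 a :*: Phi2 b.
Proof.
have -> : cospan_hcomp a b = cospan_vcomp (cospan_hcomp a (cospan_id2 d))
    (cospan_hcomp (cospan_id2 c') b) by apply: cospan_cell_irr.
by rewrite Phi2_vcomp Phi2_whiskr Phi2_whiskl -(sr_Phi2 b) -(tg_Phi2 a) hc_lr.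
Qed.

End CospanValues.

Local Open Scope twocat_scope.

(** * The cells of a strict monoidal 2-category *)

Section TotalCells.
Variable C : strictMon2Cat.
Implicit Types u v w : twocell C.

Definition hcomp_along u v (e : ccod u = cdom v) : twocell C :=
  match e in _ = y return
    forall z (g g' : hom y z), cell g g' -> twocell C
  with erefl => fun z g g' b => Cell (twocell_cell u ** b) end
  _ _ _ (twocell_cell v).

(** Comparing bundled 1-cells aligns both end objects and the middle 1-cell in a single
    elimination. *)
Definition vcomp_along u v (e : Arrow (ctgt u) = Arrow (csrc v)) : twocell C :=
  match e in _ = f return
    forall h : hom (adom f) (acod f), cell (arrow_hom f) h -> twocell C
  with erefl => fun h b => Cell (twocell_cell u ;v b) end
  _ (twocell_cell v).

(** Composability is decided classically; [None] is the absorbing value. *)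
Definition ohc (o o' : option (twocell C)) : option (twocell C) :=
  match o, o' with
  | Some u, Some v =>
      if pselect (ccod u = cdom v) is left e then Some (hcomp_along e) else None
  | _, _ => None
  end.

Definition ovc (o o' : option (twocell C)) : option (twocell C) :=
  match o, o' with
  | Some u, Some v =>
      if pselect (Arrow (ctgt u) = Arrow (csrc v)) is left e
      then Some (vcomp_along e) else None
  | _, _ => None
  end.

Definition otn (o o' : option (twocell C)) : option (twocell C) :=
  match o, o' with
  | Some u, Some v => Some (Cell (twocell_cell u \ox2 twocell_cell v))
  | _, _ => None
  end.

Definition oid2 (x y : C) (f : hom x y) : option (twocell C) :=
  Some (Cell (id2 f)).
Definition oid1 (x : C) : option (twocell C) := oid2 (id1 x).
Definition odm (o : option (twocell C)) :=
  if o is Some u then oid1 (cdom u) else None.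
Definition ocd (o : option (twocell C)) :=
  if o is Some u then oid1 (ccod u) else None.
Definition osr (o : option (twocell C)) :=
  if o is Some u then oid2 (csrc u) else None.
Definition otg (o : option (twocell C)) :=
  if o is Some u then oid2 (ctgt u) else None.

Lemma oid1_inj (x y : C) : oid1 x = oid1 y -> x = y.
Proof. by case. Qed.

Lemma oid2_inj (x y x' y' : C) (f : hom x y) (g : hom x' y') :
  oid2 f = oid2 g -> Arrow f = Arrow g.
Proof. exact: (congr1 (fun o => if o is Some u then Arrow (csrc u) else
  Arrow f)). Qed.

(** Case analysis on this family, via [ohcP], turns a provable equality of middle objects into a
    definitional one; [vcomp_spec] does the same for 1-cells. *)
Variant hcomp_spec : twocell C -> twocell C -> option (twocell C) -> Prop :=
  HcompSpec (x y z : C) (f f' : hom x y) (g g' : hom y z) (a : cell f f')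
    (b : cell g g') : hcomp_spec (Cell a) (Cell b) (Some (Cell (a ** b))).

Variant vcomp_spec : twocell C -> twocell C -> option (twocell C) -> Prop :=
  VcompSpec (x y : C) (f g h : hom x y) (a : cell f g) (b : cell g h) :
    vcomp_spec (Cell a) (Cell b) (Some (Cell (a ;v b))).

Lemma ohcE (x y z : C) (f f' : hom x y) (g g' : hom y z) (a : cell f f')
  (b : cell g g') : ohc (Some (Cell a)) (Some (Cell b)) = Some (Cell (a ** b)).
Proof. by rewrite /=; case: pselect => // e;
  rewrite (Prop_irrelevance e erefl). Qed.

Lemma ovcE (x y : C) (f g h : hom x y) (a : cell f g) (b : cell g h) :
  ovc (Some (Cell a)) (Some (Cell b)) = Some (Cell (a ;v b)).
Proof. by rewrite /=; case: pselect => // e;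
  rewrite (Prop_irrelevance e erefl). Qed.

Lemma ohcP u v : ccod u = cdom v -> hcomp_spec u v (ohc (Some u) (Some v)).
Proof.
case: u v => x y f f' a [y' z g g' b] /= e; case: _ / e g g' b => g g' b.
by rewrite -/(ohc (Some (Cell a)) (Some (Cell b))) ohcE.
Qed.

Lemma ovcP u v : Arrow (ctgt u) = Arrow (csrc v) ->
  vcomp_spec u v (ovc (Some u) (Some v)).
Proof.
case: u v => x y f g a [x' y' g' h b] e.
(* The source of the second cell is generalised to an arbitrary bundled arrow, so that the equality
   can be eliminated. *)
suff H (w : arrow C) (ew : Arrow g = w) (k : hom (adom w) (acod w))
  (c : cell (arrow_hom w) k) :
    vcomp_spec (Cell a) (Cell c) (ovc (Some (Cell a)) (Some (Cell c))).
  exact: (H _ e _ b).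
by case: _ / ew k c => k c; rewrite ovcE.
Qed.

Lemma ohcN u v : ccod u <> cdom v -> ohc (Some u) (Some v) = None.
Proof. by rewrite /=; case: pselect. Qed.

Lemma ohc0 o : ohc o None = None. Proof. by case: o. Qed.
Lemma otn0 o : otn o None = None. Proof. by case: o. Qed.

Arguments ohc : simpl never.
Arguments ovc : simpl never.

Lemma ohcA : associative ohc.
Proof.
move=> [u|] [v|] [w|]; rewrite ?ohc0 //.
have [e|ne] := pselect (ccod u = cdom v); last first.
  rewrite (ohcN ne); have [e'|ne'] := pselect (ccod v = cdom w);
    last by rewrite (ohcN ne').
  by case: (ohcP e') ne => *; rewrite ohcN.
case: (ohcP e) => x y z f f' g g' a b.
have [e'|ne'] := pselect (z = cdom w); last by rewrite !ohcN.
case: w e' => z' t h h' c /= e'; case: _ / e' h h' c => h h' c.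
by rewrite !ohcE hcompA.
Qed.

Lemma ohc_dm o : ohc (odm o) o = o.
Proof. by case: o => // -[x y f g a]; rewrite ohcE hcomp_1a. Qed.

Lemma ohc_cd o : ohc o (ocd o) = o.
Proof. by case: o => // -[x y f g a]; rewrite ohcE hcomp_a1. Qed.

Lemma odm_ohc o o' : ocd o = odm o' -> odm (ohc o o') = odm o.
Proof. by case: o o' => [u|] [v|] // /oid1_inj /ohcP[]. Qed.

Lemma ocd_ohc o o' : ocd o = odm o' -> ocd (ohc o o') = ocd o'.
Proof. by case: o o' => [u|] [v|] // /oid1_inj /ohcP[]. Qed.

Lemma ovc_sr o : ovc (osr o) o = o.
Proof. by case: o => // -[x y f g a]; rewrite ovcE vcomp_1a. Qed.

Lemma ovc_tg o : ovc o (otg o) = o.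
Proof. by case: o => // -[x y f g a]; rewrite ovcE vcomp_a1. Qed.

Lemma osr_ovc o o' : otg o = osr o' -> osr (ovc o o') = osr o.
Proof. by case: o o' => [u|] [v|] // /oid2_inj /ovcP[]. Qed.

Lemma otg_ovc o o' : otg o = osr o' -> otg (ovc o o') = otg o'.
Proof. by case: o o' => [u|] [v|] // /oid2_inj /ovcP[]. Qed.

Lemma osr_ohc o o' : osr (ohc o o') = ohc (osr o) (osr o').
Proof.
case: o o' => [u|] [v|] //.
have [e|ne] := pselect (ccod u = cdom v); last by rewrite !ohcN.
by case: (ohcP e) => *; rewrite ohcE hcomp_id2.
Qed.

Lemma otg_ohc o o' : otg (ohc o o') = ohc (otg o) (otg o').
Proof.
case: o o' => [u|] [v|] //.
have [e|ne] := pselect (ccod u = cdom v); last by rewrite !ohcN.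
by case: (ohcP e) => *; rewrite ohcE hcomp_id2.
Qed.

Lemma ohc_ovc o1 o1' o2 o2' : otg o1 = osr o1' -> otg o2 = osr o2' ->
  ohc (ovc o1 o1') (ovc o2 o2') = ovc (ohc o1 o2) (ohc o1' o2').
Proof.
case: o1 o1' o2 o2' => [u|] [u'|] // [v|] [v'|] //; rewrite ?ohc0 //.
move=> /oid2_inj /ovcP[x y f g h a b] /oid2_inj /ovcP[x' y' f' g' h' a' b'].
have [e|ne] := pselect (y = x'); last by rewrite !ohcN.
by case: _ / e f' g' h' a' b' => f' g' h' a' b'; rewrite !ohcE ovcE hcomp_vcomp.
Qed.

Lemma otnA : associative otn.
Proof.
move=> [[x y f f' a]|] [[x' y' g g' b]|] [[x'' y'' h h' c]|] //=.
by rewrite tens2A.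
Qed.

Lemma otn1o : left_id (oid1 munit) otn.
Proof. by case=> // -[x y f g a]; rewrite /= tens2_1a. Qed.

Lemma otno1 : right_id (oid1 munit) otn.
Proof. by case=> // -[x y f g a]; rewrite /= tens2_a1. Qed.

Lemma tens1_id (x y : C) : id1 x \ox1 id1 y = id1 (x \ox y).
Proof. exact: (F1_id (@tens C) (x, y)). Qed.

Lemma tens2_id (x y x' y' : C) (f : hom x y) (f' : hom x' y') :
  id2 f \ox2 id2 f' = id2 (f \ox1 f').
Proof. exact: (@F2_id _ _ (@tens C) (x, x') (y, y') (f, f')). Qed.

Lemma otn_id2 (x y x' y' : C) (f : hom x y) (f' : hom x' y') :
  otn (oid2 f) (oid2 f') = oid2 (f \ox1 f').
Proof. by rewrite /= tens2_id. Qed.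

Lemma otn_id1 (x y : C) : otn (oid1 x) (oid1 y) = oid1 (x \ox y).
Proof. by rewrite otn_id2 tens1_id. Qed.

Lemma odm_otn o o' : odm (otn o o') = otn (odm o) (odm o').
Proof. by case: o o' => [u|] [v|] //; rewrite otn_id1. Qed.

Lemma ocd_otn o o' : ocd (otn o o') = otn (ocd o) (ocd o').
Proof. by case: o o' => [u|] [v|] //; rewrite otn_id1. Qed.

Lemma osr_otn o o' : osr (otn o o') = otn (osr o) (osr o').
Proof. by case: o o' => [u|] [v|] //; rewrite otn_id2. Qed.

Lemma otg_otn o o' : otg (otn o o') = otn (otg o) (otg o').
Proof. by case: o o' => [u|] [v|] //; rewrite otn_id2. Qed.

Lemma otn_ohc o1 o1' o2 o2' : ocd o1 = odm o1' -> ocd o2 = odm o2' ->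
  otn (ohc o1 o1') (ohc o2 o2') = ohc (otn o1 o2) (otn o1' o2').
Proof.
case: o1 o1' o2 o2' => [u|] [u'|] // [v|] [v'|] //; rewrite ?otn0 ?ohc0 //.
move=> /oid1_inj /ohcP[x y z f f' g g' a b] /oid1_inj.
move=> /ohcP[x' y' z' h h' k k' a' b']; rewrite ohcE.
congr Some; exact: (@F2_hcomp _ _ (@tens C) (x, x') (y, y') (z, z')
  (f, h) (f', h') (g, k) (g', k') (a, a') (b, b')).
Qed.

Definition cells : cellAlg.
Proof.
refine (@CellAlg (option (twocell C)) ohc ovc otn odm ocd osr otg (oid1 munit)
  ohcA ohc_dm ohc_cd _ _ _ _ odm_ohc ocd_ohc ovc_sr ovc_tg _ _ osr_ovc otg_ovc
  _ _ _ _ osr_ohc otg_ohc ohc_ovc otnA otn1o otno1 _ odm_otn ocd_otn osr_otn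
  otg_otn otn_ohc); by try case.
Defined.

End TotalCells.

Arguments ohc : simpl never.
Arguments ovc : simpl never.
Arguments otn : simpl never.
Arguments oid2 : simpl never.

(** Proof irrelevance makes every transport along a loop trivial. *)
Lemma existT_inj (T : Type) (P : T -> Type) (x : T) (a b : P x) :
  existT P x a = existT P x b -> a = b.
Proof.
move=> e; pose cast (w : {y & P y}) (ew : projT1 w = x) := ecast y (P y) ew
  (projT2 w).
suff H w w' (e' : w = w') ew ew' : cast w ew =
  cast w' ew' by exact: (H _ _ e erefl erefl).
by case: _ / e' ew' => ew'; rewrite (Prop_irrelevance ew ew').
Qed.

Section Injectivity.
Variables (C : twoData) (x y : C).

Lemma Arrow_inj (f g : hom x y) : Arrow f = Arrow g -> f = g.
Proof. by case=> e; exact: (existT_inj (existT_inj e)). Qed.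

Lemma Cell_inj (f g : hom x y) (a b : cell f g) : Cell a = Cell b -> a = b.
Proof. by case=> e; exact:
  (existT_inj (existT_inj (existT_inj (existT_inj e)))). Qed.

End Injectivity.

(** Bundled 2-cells carry their boundary: the images of identity 2-cells determine the functor on
    1-cells, and those of identity 1-cells determine it on objects. *)
Lemma twoFunctor_eq (C D : twoCat) (F G : twoFunctor C D) :
  (forall (x y : C) (f g : hom x y) (a : cell f g),
    Cell (F2 F a) = Cell (F2 G a)) ->
  F = G.
Proof.
move=> e2.
have e1 (x y : C) (f : hom x y) : Arrow (F1 F f) = Arrow (F1 G f).
  exact: (congr1 (fun u : twocell D => Arrow (csrc u)) (e2 _ _ _ _ (id2 f))).
have e0 x : F x = G x := congr1 (@adom D) (e1 x x (id1 x)).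
case: F G e0 e1 e2 => F0 F1 F2 a b c d e [G0 G1 G2 a' b' c' d' e'] /=.
move=> /funext e0; case: _ / e0 G1 G2 a' b' c' d' e' => G1 G2 a' b' c' d' e' e1.
have {}e1 : F1 = G1.
  apply: functional_extensionality_dep => x;
    apply: functional_extensionality_dep => y.
  by apply: funext => f; apply: Arrow_inj.
case: _ / e1 G2 a' b' c' d' e' => G2 a' b' c' d' e' e2.
have {}e2 : F2 = G2.
  apply: functional_extensionality_dep => x;
    apply: functional_extensionality_dep => y.
  apply: functional_extensionality_dep => f;
    apply: functional_extensionality_dep => g.
  by apply: funext => h; apply: Cell_inj.
case: _ / e2 a' b' c' d' e' => a' b' c' d' e'.
by congr TwoFunctor; apply: Prop_irrelevance.
Qed.

Lemma strictMon2Functor_eq (C D : strictMon2Cat) (F G : strictMon2Functor C D) :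
  (forall (x y : C) (f g : hom x y) (a : cell f g),
    Cell (F2 F a) = Cell (F2 G a)) ->
  F = G.
Proof.
case: F G => F a b c d [G a' b' c' d'] /= /twoFunctor_eq e.
case: _ / e a' b' c' d' => a' b' c' d'.
by congr StrictMon2Functor; apply: Prop_irrelevance.
Qed.

(** * Passage between the typed and the one-sorted setting *)

Section ComoInstance.
Variable C : strictMon2Cat.

Lemma oid2_eq (x y x' y' : C) (f : hom x y) (g : hom x' y') :
  Arrow f = Arrow g -> oid2 f = oid2 g.
Proof. exact: (congr1 (fun w => oid2 (arrow_hom w))). Qed.

Lemma ohc_id2 (x y z : C) (f : hom x y) (g : hom y z) :
  ohc (oid2 f) (oid2 g) = oid2 (f ;; g).
Proof. by rewrite ohcE hcomp_id2. Qed.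

(** Removes the transport from the typed Frobenius laws: [ohc] does not depend on the proof that the
    middle objects agree. *)
Lemma ohc_along (x y y' z : C) (e : y = y') (f : hom x y) (g : hom y' z) :
  ohc (oid2 f) (oid2 g) = oid2 (comp1_along e f g).
Proof. by case: _ / e g => g; rewrite ohc_id2. Qed.

(** The way back to typed cells; choice ([cid]) makes the existence a datum from which a functor can
    be defined. *)
Lemma hom_of (x y : C) (o : option (twocell C)) :
  odm o = oid1 x -> ocd o = oid1 y -> osr o = o -> {f : hom x y | oid2 f = o}.
Proof.
move=> ed ec es; apply: cid; case: o ed ec es => // -[x' y' f g a].
move=> /oid1_inj /= ex /oid1_inj /= ey <-.
by case: _ / ex f g a => f g a; case: _ / ey f g a => f g a; exists f.
Qed.

Lemma cell_of (x y : C) (f g : hom x y) (o : option (twocell C)) :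
  osr o = oid2 f -> otg o = oid2 g -> {a : cell f g | Some (Cell a) = o}.
Proof.
move=> es et; apply: cid; case: o es et => // -[x' y' f' g' a] /oid2_inj es
  /oid2_inj et.
have ex := congr1 (@adom C) es; have ey := congr1 (@acod C) es;
  rewrite /= in ex ey.
case: _ / (esym ex) f' g' a es et => f' g' a;
  case: _ / (esym ey) f' g' a => f' g' a /Arrow_inj es /Arrow_inj et.
case: _ / es; case: _ / et; by exists a.
Qed.

Variable A : comoAlgebra C.

Definition como_cells : comoCells (cells C).
Proof.
refine (@ComoCells (cells C) (oid1 (como_ob A)) (oid2 (nabla A))
  (oid2 (delta A))
  (Some (Cell (eta A))) _ _ _ _ _ _ _ _ _ _ _ _ _ _ _ _) => /=.
all: rewrite ?otn_id2 ?tens1_id ?ohc_id2 //.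
- exact/oid2_eq/nablaA.
- exact/oid2_eq/deltaA.
- by rewrite como_separable.
- by rewrite (ohc_along (esym (tens0A _ _ _))) como_frobeniusl.
- by rewrite (ohc_along (tens0A _ _ _)) como_frobeniusr.
- by rewrite ohcE eta_nabla.
- by rewrite ohcE delta_eta.
Defined.

(** Ends in [munit], as [pw] ends in [un]; hence [obn 1] is [como_ob A] only up to [tens0_x1]. *)
Fixpoint obn (n : nat) : C :=
  if n is n'.+1 then como_ob A \ox obn n' else munit.

Lemma pw_obn n : pw como_cells n = oid1 (obn n).
Proof. by elim: n => //= n ->; rewrite otn_id1. Qed.

End ComoInstance.

(** * Existence *)

(** The codomain stays a variable because that of [eta1_map] is a pushout apex, only provably equal
    to 1. *)
Lemma code_sto1 n m (f : sLin n m) : m = 1 -> code f = nseq n 0.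
Proof.
move=> m1; apply: (@eq_from_nth _ 0) => [|i];
  rewrite size_code ?size_nseq // => lt_in.
rewrite nth_nseq lt_in -[i]/(val (Ordinal lt_in)) nth_code.
by apply/eqP; rewrite -leqn0 -ltnS -[X in _ < X]m1.
Qed.

Section Merge.
Variables (E : cellAlg) (A : comoCells E) (m : nat) (f : sLin 2 m).
Hypothesis m1 : m = 1.

Lemma dm_ceta : dm (ceta A) = cob A :x: cob A.
Proof. by rewrite -dm_sr sr_ceta dm_tn dm_cob. Qed.

Lemma cd_ceta : cd (ceta A) = cob A :x: cob A.
Proof. by rewrite -cd_sr sr_ceta cd_tn cd_cob. Qed.

Lemma Sf_merge : Sf A f = cnab A.
Proof. by rewrite /Sf /bits code_sto1 //= tnu1 -dm_cnab hc_dm. Qed.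

Lemma Tf_merge : Tf A f = cdel A.
Proof. by rewrite /Tf /bits code_sto1 //= Tw_true /= tnu1 -cd_cdel hc_cd. Qed.

Lemma Hf_merge : Hf A f = ceta A.
Proof.
rewrite /Hf /bits code_sto1 //= tnu1 -dm_ceta hc_dm dm_ceta -cd_ceta hc_cd.
by rewrite cd_ceta -sr_ceta vc_sr.
Qed.

End Merge.

Section Existence.
Variables (D : strictMon2Cat) (A : comoAlgebra D).
Local Notation AC := (como_cells A).

Definition hom_Phi1 x y (c : cospan x y) :
  {f : hom (obn A x) (obn A y) | oid2 f = Phi1 AC c}.
Proof.
apply: hom_of; rewrite -?pw_obn.
- exact: (dm_Phi1 AC c).
- exact: (cd_Phi1 AC c).
- exact: (sr_Phi1 AC c).
Qed.

Definition lift1 x y (c : cospan x y) := projT1 (hom_Phi1 c).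

Lemma lift1E x y (c : cospan x y) : oid2 (lift1 c) = Phi1 AC c.
Proof. exact: projT2 (hom_Phi1 c). Qed.

Definition cell_Phi2 x y (c d : cospan x y) (a : cospan_cell c d) :
  {b : cell (lift1 c) (lift1 d) | Some (Cell b) = Phi2 AC a}.
Proof.
apply: cell_of; rewrite lift1E.
- exact: (sr_Phi2 AC a).
- exact: (tg_Phi2 AC a).
Qed.

Definition lift2 x y (c d : cospan x y) (a : cospan_cell c d) :=
  projT1 (cell_Phi2 a).

Lemma lift2E x y (c d : cospan x y) (a : cospan_cell c d) :
  Some (Cell (lift2 a)) = Phi2 AC a.
Proof. exact: projT2 (cell_Phi2 a). Qed.

Lemma Some_Cell_inj (C : twoData) (x y : C) (f g : hom x y) (a b : cell f g) :
  Some (Cell a) = Some (Cell b) -> a = b.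
Proof. by move/Some_inj/Cell_inj. Qed.

Lemma oid2_hom_inj (x y : D) (f g : hom x y) : oid2 f = oid2 g -> f = g.
Proof. by move/oid2_inj/Arrow_inj. Qed.

(** Bundling is injective on cells with fixed boundary, so each law reduces to the matching law of
    [Phi1] or [Phi2]. *)
Definition lift_functor : twoFunctor cospan_sLin D.
Proof.
refine (@TwoFunctor cospan_sLin D (obn A) lift1 lift2 _ _ _ _ _).
- by move=> x; apply: oid2_hom_inj; rewrite lift1E (Phi1_id AC) pw_obn.
- by move=> x y z f g; apply: oid2_hom_inj;
  rewrite -ohc_id2 !lift1E (Phi1_comp AC).
- by move=> x y f; apply: Some_Cell_inj; rewrite lift2E (Phi2_id AC) -lift1E.
- by move=> x y f g h a b; apply: Some_Cell_inj;
  rewrite -ovcE !lift2E (Phi2_vcomp AC).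
- move=> x y z f f' g g' a b; apply: Some_inj.
  by rewrite -ohcE !lift2E (Phi2_hcomp AC).
Defined.

Lemma obn_add m n : obn A (m + n) = obn A m \ox obn A n.
Proof. by apply: oid1_inj; rewrite -otn_id1 -!pw_obn pwD. Qed.

Definition como_functor : strictMon2Functor cospan_sLin D.
Proof.
refine (@StrictMon2Functor cospan_sLin D lift_functor _ obn_add _ _) => //.
- move=> x y x' y' f f'; apply: oid2_inj.
  by rewrite -otn_id2 !lift1E (Phi1_add AC).
- move=> x y x' y' f g f' g' a a'; apply: Some_inj.
  rewrite -[RHS]/(otn (Some (Cell (lift2 a))) (Some (Cell (lift2 a')))) !lift2E.
  exact: (Phi2_add AC).
Defined.

Lemma como_functor_maps_como : maps_como como_functor como1 A.
Proof.
(* The codomain of [eta1_map], as [Hf_merge] requires. *)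
have po1 : po_ob (sid 1) (sid 1) = 1 by apply: po_ob1l.
have pw1 : pw AC 1 = cob AC := tnu1 (cob AC).
have pw2 : pw AC 2 = tn (cob AC) (cob AC) := congr1 (tn (cob AC)) pw1.
split=> /=.
- exact: tens0_x1.
- apply: oid2_inj; apply: etrans (lift1E nabla1) _.
  rewrite -[LHS]/(hc (Sf AC (sto1 1)) (Tf AC (sid 1))) (Sf_merge AC) //
    Tf_sid pw1.
  by rewrite -(cd_cnab AC) hc_cd.
- apply: oid2_inj; apply: etrans (lift1E delta1) _.
  rewrite -[LHS]/(hc (Sf AC (sid 1)) (Tf AC (sto1 1))) (Tf_merge AC) //
    Sf_sid pw1.
  by rewrite -(dm_cdel AC) hc_dm.
- apply: Some_inj; apply: etrans (lift2E eta1) _.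
  rewrite -[LHS]/(hc (hc (Sf AC (sid 2)) (Hf AC eta1_map)) (Tf AC (sid 2))).
  rewrite Sf_sid Tf_sid (Hf_merge AC) //.
  by rewrite pw2 -{1}(dm_ceta AC) hc_dm -(cd_ceta AC) hc_cd.
Qed.

End Existence.

(** * Uniqueness *)

(** A surjection that is not an identity identifies some neighbours [k] and [k.+1], hence factors
    through the elementary merge of these two, which has a smaller target. *)
Lemma sLin_ind (P : forall n m, sLin n m -> Prop) :
  (forall n, P n n (sid n)) ->
  (forall i j m (f : sLin (i + 1 + j) m), P _ _ f ->
     P _ _ (scomp (sadd (sadd (sid i) (sto1 1)) (sid j)) f)) ->
  forall n m (f : sLin n m), P n m f.
Proof.
move=> P1 PS n; elim/ltn_ind: n => n IHn m f.
have [lt_mn|le_nm] := ltnP m n; last first.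
  have e : n = m by apply/eqP; rewrite eqn_leq le_nm (sLin_leq f).
  by case: _ / e f => f; rewrite (sLin_endo f).
(* Were all bits [false], [count_bits] would give [m = n]. *)
have : has id (bits f).
  case: n f {IHn} lt_mn => // n f; apply: contraTT;
    rewrite -all_predC all_count.
  by rewrite size_bits /= => /eqP eb; rewrite -(count_bits f) eb ltnn.
move=> hb; pose k := find id (bits f).
have lt_k1 : k.+1 < n by rewrite -ltn_predRL -(size_bits f) -has_find.
pose k0 := Ordinal (ltnW lt_k1); pose k1 := Ordinal lt_k1.
have fk : f k0 = f k1.
  by apply/eqP; rewrite -(@nth_bits _ _ f k0 k1 erefl);
    exact: (nth_find false hb).
have [j ej] : exists j, n = k + 2 + j.
  by exists (n - (k + 2)); rewrite subnKC // addn2.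
clearbody k; subst n.
pose s := sadd (sadd (sid k) (sto1 1)) (sid j).
(* The elementary merge fixes positions up to [k] and lowers the later ones by one, so it identifies
   only [k] and [k.+1]. *)
have sE (x : 'I_(k + 2 + j)) : s x = (if x <= k then x : nat else x.-1) :> nat.
  rewrite /s; case: (split_ordP x) => y ->; last first.
    by rewrite sadd_rshift sidE /= addn2 addn1 addSn leqNgt ltnW // ltnS
      leq_addr.
  rewrite sadd_lshift; case: (split_ordP y) => t ->.
    by rewrite sadd_lshift sidE /= ltnW.
  rewrite sadd_rshift /= ord1 addn0 -[X in _ <= X]addn0 leq_add2l.
  by case: t => [[|[|t]]] //= _; rewrite ?addn0 ?addn1.
have ker x y : s x = s y -> f x = f y.
  move=> e; wlog lt_xy : x y e / x < y => [IH|].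
    by have [/IH->|/IH->|/val_inj->] := ltngtP x y.
  move/(congr1 val): e; rewrite /= !sE; have [le_xk|lt_kx] := leqP x k.
    have [_ exy|lt_ky exy] := leqP y k; first by rewrite exy ltnn in lt_xy.
    have ey : y = x.+1 :> nat by rewrite exy prednK // (leq_ltn_trans _ lt_xy).
    have ex : x = k :> nat by apply/eqP; rewrite eqn_leq le_xk -ltnS -ey.
    have -> : x = k0 by apply: val_inj.
    by rewrite fk; congr (f _); apply: val_inj; rewrite /= ey ex.
  rewrite leqNgt (ltn_trans lt_kx lt_xy) /= => exy.
  by have := lt_xy; rewrite -(ltn_predK lt_kx) exy (ltn_predK lt_xy) ltnn.
rewrite -(sdescK ker); apply: PS; apply: IHn.
by rewrite ltn_add2r addn1 addn2.
Qed.

(** Only composable pairs are required to be preserved: a functor may identify objects and so make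
    images composable whose originals are not. *)
Record cellMorph (E E' : cellAlg) := CellMorph {
  cmap :> E -> E';
  cmap_hc : forall u v, cd u = dm v -> cmap (hc u v) = hc (cmap u) (cmap v);
  cmap_vc : forall u v, tg u = sr v -> cmap (vc u v) = vc (cmap u) (cmap v);
  cmap_tn : forall u v, cmap (tn u v) = tn (cmap u) (cmap v);
  cmap_un : cmap un = un
}.

Definition flip_morph (E E' : cellAlg) (F : cellMorph E E') :
  cellMorph (flip E) (flip E') :=
  @CellMorph (flip E) (flip E') F (fun u v e => cmap_hc F (esym e)) (cmap_vc F)
    (cmap_tn F) (cmap_un F).

Section Morph.
Variables (E E' : cellAlg) (F : cellMorph E E') (A : comoCells E)
    (A' : comoCells E').
Hypotheses (Fd : F (cob A) = cob A') (Fn : F (cnab A) = cnab A').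

Lemma cmap_pw n : F (pw A n) = pw A' n.
Proof. by elim: n => [|n IHn] /=; rewrite ?cmap_un // cmap_tn Fd IHn. Qed.

Lemma cmap_Sw b : F (Sw A b) = Sw A' b.
Proof.
elim: b => [|[] b IHb] //=; last by rewrite cmap_tn Fd IHb.
by rewrite cmap_hc; [rewrite !cmap_tn Fd IHb Fn cmap_pw | bdry].
Qed.

End Morph.

Section MorphCospan.
Variables (E E' : cellAlg) (F : cellMorph E E') (A : comoCells E)
    (A' : comoCells E').
Hypotheses (Fd : F (cob A) = cob A') (Fn : F (cnab A) = cnab A').
Hypotheses (Fdel : F (cdel A) = cdel A') (Fe : F (ceta A) = ceta A').

Lemma cmap_Tw b : F (Tw A b) = Tw A' b.
Proof. exact: (@cmap_Sw _ _ (flip_morph F) (flip_como A) (flip_como A')). Qed.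

Lemma cmap_Hw b : F (Hw A b) = Hw A' b.
Proof.
have FS := cmap_Sw Fd Fn.
elim: b => [|[] b IHb] //=; last by rewrite cmap_tn Fd IHb.
(* [e1] and [e2] are the composability conditions for the whiskered unit; the one for the vertical
   composite is proved after them. *)
have e1 : cd (cob A :x: Sw A b) = dm (ceta A :x: pw A (count negb b)).
  by rewrite dm_tn dm_ceta; bdry.
have e2 : cd (cob A :x: Sw A b :*: ceta A :x: pw A (count negb b)) =
  dm (cob A :x: Tw A b).
  by rewrite cd_hc // cd_tn cd_ceta !dm_tn dm_Tw dm_cob cd_pw tnA.
rewrite cmap_vc; last first.
  rewrite tg_tn (sr_tg1 (sr_cob A)) (refl_tgH (reflection_w A b)) !sr_hc !sr_tn.
  rewrite sr_cob sr_Sw sr_Tw sr_ceta sr_pw -tnA -cd_Sw -tn_cob ?dm_cd // hc_cd.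
  by rewrite tn_cob // cd_Sw dm_Tw.
by rewrite cmap_hc // cmap_hc // !cmap_tn Fd IHb // FS cmap_Tw Fe (cmap_pw Fd).
Qed.

Lemma cmap_Phi2 x y (c d : cospan x y) (a : cospan_cell c d) :
  F (Phi2 A a) = Phi2 A' a.
Proof.
have FS n m (f : sLin n m) : F (Sf A f) = Sf A' f.
  by case: n f => [|n] f; rewrite /Sf ?cmap_un // (cmap_Sw Fd Fn).
have FT n m (f : sLin n m) : F (Tf A f) = Tf A' f.
  by case: n f => [|n] f; rewrite /Tf ?cmap_un // cmap_Tw.
have FH n m (f : sLin n m) : F (Hf A f) = Hf A' f.
  by case: n f => [|n] f; rewrite /Hf ?cmap_un // cmap_Hw.
have r := reflection_f A (cell_map a).
rewrite /Phi2 !cmap_hc ?cd_hc ?FS ?FT ?FH //.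
- by rewrite cd_Sf (refl_dmH r) dm_Sf.
- by rewrite (refl_cdH r) dm_Sf dm_Tf.
- by rewrite cd_Sf (refl_dmH r) dm_Sf.
Qed.
End MorphCospan.

(** * The values computed in cospan(sLin) itself *)

Section Cospans.
Local Notation K := (cells cospan_sLin).
Local Notation KC := (como_cells como1).

Definition fwd n m (f : sLin n m) : K :=
  @oid2 cospan_sLin n m (Cospan f (sid m)).
Definition bwd n m (f : sLin n m) : K :=
  @oid2 cospan_sLin m n (Cospan (sid m) f).

(** Cospans with cells in both directions are equal: one cell comes from the universal property of
    the pushout, the other is a pushout injection. The next lemmas on composites argue alike. *)
Lemma fwd_scomp n m p (f : sLin n m) (g : sLin m p) :
  fwd (scomp f g) = hc (fwd f) (fwd g).
Proof.
rewrite /fwd -[RHS]/(ohc _ _) ohc_id2; congr oid2; apply/esym/cospan_anti.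
  by apply: (@cospan_comp_cell _ _ _ (Cospan f (sid m)) (Cospan g (sid p))
            (Cospan (scomp f g) (sid p)) g (sid p));
    rewrite /= ?scomp1f ?scompf1.
exists (po_inr (sid m) g) => //=.
by rewrite -scompA -po_comm scomp1f.
Qed.

Lemma bwd_scomp n m p (f : sLin n m) (g : sLin m p) :
  bwd (scomp f g) = hc (bwd g) (bwd f).
Proof.
rewrite /bwd -[RHS]/(ohc _ _) ohc_id2; congr oid2; apply/esym/cospan_anti.
  by apply: (@cospan_comp_cell _ _ _ (Cospan (sid p) g) (Cospan (sid m) f)
            (Cospan (sid p) (scomp f g)) (sid p) g);
    rewrite /= ?scomp1f ?scompf1.
exists (po_inl g (sid m)) => //=.
by rewrite -scompA po_comm scomp1f.
Qed.

Lemma fwd_bwd x y (c : cospan x y) :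
  hc (fwd (legl c)) (bwd (legr c)) = @oid2 cospan_sLin x y c.
Proof.
case: c => p f g; rewrite /fwd /bwd -[LHS]/(ohc _ _) ohc_id2; congr oid2;
  apply/cospan_anti.
  by apply: (@cospan_comp_cell _ _ _ (Cospan f (sid p)) (Cospan (sid p) g)
            (Cospan f g) (sid p) (sid p));
    rewrite /= ?scomp1f ?scompf1.
exists (po_inl (sid p) (sid p)) => //=.
by have := po_comm (sid p) (sid p); rewrite !scomp1f => ->.
Qed.

Lemma fwd_sadd n m n' m' (f : sLin n m) (f' : sLin n' m') :
  fwd (sadd f f') = tn (fwd f) (fwd f').
Proof.
rewrite /fwd -[RHS]/(otn _ _) otn_id2; congr oid2.
by rewrite /tens1 /= /cospan_add /= sadd_id.
Qed.

Lemma bwd_sadd n m n' m' (f : sLin n m) (f' : sLin n' m') :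
  bwd (sadd f f') = tn (bwd f) (bwd f').
Proof.
rewrite /bwd -[RHS]/(otn _ _) otn_id2; congr oid2.
by rewrite /tens1 /= /cospan_add /= sadd_id.
Qed.

Lemma pw_cospan n : pw KC n = @oid1 cospan_sLin n.
Proof. by rewrite pw_obn; congr oid1; elim: n => //= n ->. Qed.

(** Both sides respect composition and tensor, and they agree on the merge of two points, which
    generates by [sLin_ind]. *)
Lemma Sf_cospan n m (f : sLin n m) : Sf KC f = fwd f.
Proof.
elim/sLin_ind: n m / f => [n|i j m f IHf]; first by rewrite Sf_sid pw_cospan.
rewrite Sf_scomp !Sf_sadd !Sf_sid !pw_cospan IHf fwd_scomp !fwd_sadd.
by rewrite (Sf_merge KC).
Qed.

Lemma Tf_cospan n m (f : sLin n m) : Tf KC f = bwd f.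
Proof.
elim/sLin_ind: n m / f => [n|i j m f IHf]; first by rewrite Tf_sid pw_cospan.
rewrite Tf_scomp !Tf_sadd !Tf_sid !pw_cospan IHf bwd_scomp !bwd_sadd.
by rewrite (Tf_merge KC).
Qed.

(** A 2-cell between cospans is determined by its boundary, so only source and target need to be
    computed. *)
Lemma Phi2_cospan x y (c d : cospan x y) (a : cospan_cell c d) :
  Phi2 KC a = Some (@Cell cospan_sLin _ _ _ _ a).
Proof.
have es := sr_Phi2 KC a; have et := tg_Phi2 KC a.
rewrite /Phi1 Sf_cospan Tf_cospan fwd_bwd in es.
rewrite /Phi1 Sf_cospan Tf_cospan fwd_bwd in et.
have [b <-] := cell_of es et.
by rewrite (cospan_cell_irr a b).
Qed.

End Cospans.

Section Uniqueness.
Variables (D : strictMon2Cat) (A : comoAlgebra D)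
    (F : strictMon2Functor cospan_sLin D).
Hypothesis FA : maps_como F como1 A.

Definition map_cells (C : strictMon2Cat) (F : strictMon2Functor C D)
    (o : cells C) : cells D :=
  omap (fun u : twocell C => Cell (F2 F (twocell_cell u))) o.

Lemma map_cells_id2 (C : strictMon2Cat) (G : strictMon2Functor C D) (x y : C)
    (f : hom x y) :
  map_cells G (oid2 f) = oid2 (F1 G f).
Proof. by rewrite /map_cells /= F2_id. Qed.

Definition functor_morph (C : strictMon2Cat) (G : strictMon2Functor C D) :
  cellMorph (cells C) (cells D).
Proof.
refine (@CellMorph (cells C) (cells D) (map_cells G) _ _ _ _).
- move=> u v /=; case: u v => [u|] [v|] // /oid1_inj /ohcP[x y z f f' g g' a b].
  by rewrite [RHS]ohcE /= F2_hcomp.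
- move=> u v /=; case: u v => [u|] [v|] // /oid2_inj /ovcP[x y f g h a b].
  by rewrite [RHS]ovcE /= F2_vcomp.
- move=> [[x y f g a]|] [[x' y' f' g' a']|] //.
  by rewrite /= /otn /= F2_tens.
- by apply: etrans (map_cells_id2 G (id1 munit)) _; rewrite F1_id F0_unit.
Defined.

(** By [Phi2_cospan] the cell [a] is itself an expression in the Como-algebra of cospan(sLin), and
    [F] preserves such expressions. *)
Lemma F2_unique x y (c d : cospan x y) (a : cospan_cell c d) :
  Some (Cell (F2 F (a : @cell cospan_sLin x y c d))) = Phi2 (como_cells A) a.
Proof.
case: FA => F0e Fn Fd Fe.
rewrite -(@cmap_Phi2 _ _ (functor_morph F) (como_cells como1)) ?Phi2_cospan //.
- by apply: etrans (map_cells_id2 F (id1 _)) _; rewrite F1_id F0e.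
- by apply: etrans (map_cells_id2 F _) _; apply: oid2_eq.
- by apply: etrans (map_cells_id2 F _) _; apply: oid2_eq.
- exact: (congr1 (@Some (twocell D)) Fe).
Qed.

End Uniqueness.

Theorem proposition8p9 (D : strictMon2Cat) (A : comoAlgebra D) :
  exists! F : strictMon2Functor cospan_sLin D, maps_como F como1 A.
Proof.
exists (como_functor A); split; first exact: como_functor_maps_como.
move=> G GA; apply: strictMon2Functor_eq => x y f g a; apply: Some_inj.
by rewrite (F2_unique (como_functor_maps_como A)) (F2_unique GA).
Qed.
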